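(* Let $D$ be an integral domain and let $(\mathcal{X},\mathcal{O}_{\mathcal{X}})$ be an integral scheme that is separated and of finite type over $D$. Assume that its function field is $K$, where $K$ is a field containing $D$ as a subring, the inclusion $D\subseteq K$ being the map induced by the structure morphism $\mathcal{X}\to\operatorname{Spec}D$. Then there is a model $\mathcal{Y}$ of $K$ over $D$ such that the corresponding scheme $(\mathcal{Y},\mathcal{O}_{\mathcal{Y}})$ is isomorphic to $(\mathcal{X},\mathcal{O}_{\mathcal{X}})$.
   Context: Rings are commutative with identity; nothing is assumed Noetherian. $\mathcal{L}(K/D)$ is the set of local domains $R$ with $D\subseteq R\subseteq K$ and fraction field $K$. For an integral domain $A$, $\mathcal{S}(A)=\{A_P : P\text{ a prime ideal of }A\}$ (subrings of the fraction field of $A$). A local domain $(S,M_S)$ dominates $(R,M_R)$ if $R$ is a subring of $S$ and $M_R=M_S\cap R$. A premodel of $K$ over $D$ is a nonempty subset of $\mathcal{L}(K/D)$. It is irredundant if no two distinct elements are dominated by the same valuation ring of $K$ (equivalently, by the same local domain). An affine ring over $D$ is a subring of $K$ containing $D$ that is finitely generated as a $D$-algebra. A model of $K$ over $D$ is an irredundant premodel of the form $\bigcup_{\epsilon\in\Lambda}\mathcal{S}(D_\epsilon)$ for a finite family $\{D_\epsilon\}_{\epsilon\in\Lambda}$ of affine rings over $D$. The Zariski topology on a model $\mathcal{Y}$ has as basis the sets $\{R\in\mathcal{Y}:R\supseteq H\}$, $H\subseteq K$ finite. The structure sheaf is $\mathcal{O}_{\mathcal{Y}}(U)=\bigcap_{R\in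 U}R$ for nonempty open $U$ (zero ring for $U=\emptyset$), with inclusions as restriction maps; with it $\mathcal{Y}$ is a scheme. *)

(* Defs.v *)
From HB Require Import structures.
From mathcomp Require Import all_boot all_order all_algebra.
From mathcomp Require Import generic_quotient ring.
From mathcomp Require Import all_classical topology_structure.

Set Implicit Arguments.
Unset Strict Implicit.
Unset Printing Implicit Defensive.

Import GRing.Theory.

Local Open Scope ring_scope.
Local Open Scope quotient_scope.
Local Open Scope classical_set_scope.

Identity Coercion fun_of_set : set >-> Funclass.

(* Rings are comPzRingType's, so that the zero ring is allowed: it is the ring
   of sections over the empty set. Subrings are sets, and ideals are relative to
   a subring R; for the ideals of a whole ring take R = setT. *)

Section Algebra.
Variable A : comPzRingType.
Implicit Types R I P M : set A.

Definition is_unit (x : A) := exists y, x * y = 1.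

Definition is_domain := (1 : A) <> 0 /\
  forall x y : A, x * y = 0 -> x = 0 \/ y = 0.

Definition is_subring R := [/\ R 1, forall x y, R x -> R y -> R (x - y)
  & forall x y, R x -> R y -> R (x * y)].

Definition is_ideal R I := [/\ I `<=` R, I 0,
  forall x y, I x -> I y -> I (x + y) & forall r x, R r -> I x -> I (r * x)].

Definition is_prime R P := [/\ is_ideal R P, ~ P 1
  & forall x y, R x -> R y -> P (x * y) -> P x \/ P y].

Definition is_maximal R M := [/\ is_ideal R M, ~ M 1
  & forall I, is_ideal R I -> ~ I 1 -> M `<=` I -> I = M].

Definition is_local R := is_subring R /\ exists! M, is_maximal R M.

End Algebra.

(* B is generated as a ring by phi(A) and finitely many elements, that is, B is
   a finitely generated A-algebra. *)
Definition finite_type_hom (A B : comPzRingType) (phi : A -> B) :=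
  exists s : seq B, smallest (@is_subring B) (range phi `|` [set` s]) = setT.

Record spec_pt (A : comPzRingType) := SpecPt {
  spec_ideal :> set A;
  spec_prime : is_prime setT spec_ideal }.

Section Localization.
Variables (A : comPzRingType) (P : spec_pt A).

Lemma spec_one : ~ P 1. Proof. by case: (spec_prime P). Qed.

Lemma spec_mul s t : ~ P s -> ~ P t -> ~ P (s * t).
Proof.
by case: (spec_prime P) => _ _ Pp Ps Pt /(Pp _ _ I I)[].
Qed.

Record prefrac := PreFrac { pnum : A; pden : A; pdenP : ~ P pden }.

Arguments pdenP : clear implicits.

HB.instance Definition _ := gen_eqMixin prefrac.
HB.instance Definition _ := gen_choiceMixin prefrac.

Definition frac_eq (x y : prefrac) := `[<
  exists2 t, ~ P t & t * (pnum x * pden y - pnum y * pden x) = 0 >].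

Lemma frac_eq_refl : reflexive frac_eq.
Proof.
by move=> x; apply/asboolP; exists 1; [exact: spec_one | rewrite subrr mulr0].
Qed.

Lemma frac_eq_sym : symmetric frac_eq.
Proof.
suff H x y : frac_eq x y -> frac_eq y x by move=> x y; apply/idP/idP; exact: H.
move/asboolP=> [t Pt e]; apply/asboolP; exists t => //.
by rewrite -opprB mulrN e oppr0.
Qed.

Lemma frac_eq_trans : transitive frac_eq.
Proof.
move=> y x z /asboolP[t Pt e1] /asboolP[u Pu e2]; apply/asboolP.
exists (t * u * pden y); first by do 2?apply: spec_mul => //; exact: pdenP.
transitivity (u * pden z * (t * (pnum x * pden y - pnum y * pden x))
  + t * pden x * (u * (pnum y * pden z - pnum z * pden y))); first by ring.
by rewrite e1 e2 !mulr0 addr0.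
Qed.

Canonical frac_equiv := EquivRel frac_eq frac_eq_refl frac_eq_sym frac_eq_trans.

Definition localization := {eq_quot frac_equiv}.

HB.instance Definition _ := Choice.on localization.

Definition frac (a s : A) (Ps : ~ P s) : localization :=
  \pi_localization (PreFrac a Ps).

Lemma frac_eqP a s (Ps : ~ P s) b t (Pt : ~ P t) :
  (exists2 u, ~ P u & u * (a * t - b * s) = 0) <-> frac a Ps = frac b Pt.
Proof.
split=> [h|/eqmodP /asboolP//].
by apply/eqmodP/asboolP.
Qed.

Lemma fracE a s (Ps : ~ P s) b t (Pt : ~ P t) :
  a * t = b * s -> frac a Ps = frac b Pt.
Proof.
move=> e; apply/frac_eqP; exists 1; first exact: spec_one.
by rewrite e subrr mulr0.
Qed.

Lemma fracW (x : localization) : exists a s (Ps : ~ P s), x = frac a Ps.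
Proof.
exists (pnum (repr x)), (pden (repr x)), (pdenP (repr x)).
by rewrite /frac; case: (repr x) (reprK x).
Qed.

Definition loc_add (x y : localization) : localization :=
  frac (pnum (repr x) * pden (repr y) + pnum (repr y) * pden (repr x))
    (spec_mul (pdenP (repr x)) (pdenP (repr y))).
Definition loc_opp (x : localization) : localization :=
  frac (- pnum (repr x)) (pdenP (repr x)).
Definition loc_mul (x y : localization) : localization :=
  frac (pnum (repr x) * pnum (repr y))
    (spec_mul (pdenP (repr x)) (pdenP (repr y))).

Lemma frac_repr a s (Ps : ~ P s) : exists2 u, ~ P u
  & u * (pnum (repr (frac a Ps)) * s - a * pden (repr (frac a Ps))) = 0.
Proof.
apply: (frac_eqP _ (pdenP (repr (frac a Ps))) _ Ps).2.
by rewrite -[RHS]reprK /frac; case: (repr _).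
Qed.

Lemma loc_addE a s (Ps : ~ P s) b t (Pt : ~ P t) :
  loc_add (frac a Ps) (frac b Pt) = frac (a * t + b * s) (spec_mul Ps Pt).
Proof.
rewrite /loc_add.
have [u Pu e] := frac_repr a Ps; have [v Pv e'] := frac_repr b Pt.
move: (repr (frac a Ps)) (repr (frac b Pt)) e e' => [c p Pp] [d q Pq] /= e e'.
apply/frac_eqP; exists (u * v); first exact: spec_mul.
transitivity (v * q * t * (u * (c * s - a * p))
  + u * p * s * (v * (d * t - b * q))); first by ring.
by rewrite e e' !mulr0 addr0.
Qed.

Lemma loc_oppE a s (Ps : ~ P s) : loc_opp (frac a Ps) = frac (- a) Ps.
Proof.
rewrite /loc_opp; have [u Pu e] := frac_repr a Ps.
move: (repr (frac a Ps)) e => [c p Pp] /= e.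
apply/frac_eqP; exists u => //.
transitivity (- (u * (c * s - a * p))); first by ring.
by rewrite e oppr0.
Qed.

Lemma loc_mulE a s (Ps : ~ P s) b t (Pt : ~ P t) :
  loc_mul (frac a Ps) (frac b Pt) = frac (a * b) (spec_mul Ps Pt).
Proof.
rewrite /loc_mul.
have [u Pu e] := frac_repr a Ps; have [v Pv e'] := frac_repr b Pt.
move: (repr (frac a Ps)) (repr (frac b Pt)) e e' => [c p Pp] [d q Pq] /= e e'.
apply/frac_eqP; exists (u * v); first exact: spec_mul.
transitivity (v * d * t * (u * (c * s - a * p))
  + u * p * a * (v * (d * t - b * q))); first by ring.
by rewrite e e' !mulr0 addr0.
Qed.

Fact loc_addA : associative loc_add.
Proof.
move=> x y z; have [a [s [Ps ->]]] := fracW x; have [b [t [Pt ->]]] := fracW y.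
have [c [u [Pu ->]]] := fracW z; rewrite !loc_addE; apply: fracE; ring.
Qed.

Fact loc_addC : commutative loc_add.
Proof.
move=> x y; have [a [s [Ps ->]]] := fracW x; have [b [t [Pt ->]]] := fracW y.
rewrite !loc_addE; apply: fracE; ring.
Qed.

Fact loc_add0 : left_id (frac 0 spec_one) loc_add.
Proof.
move=> x; have [a [s [Ps ->]]] := fracW x; rewrite loc_addE; apply: fracE; ring.
Qed.

Fact loc_addN : left_inverse (frac 0 spec_one) loc_opp loc_add.
Proof.
move=> x; have [a [s [Ps ->]]] := fracW x; rewrite loc_oppE loc_addE.
apply: fracE; ring.
Qed.

HB.instance Definition _ := GRing.isZmodule.Build localization
  loc_addA loc_addC loc_add0 loc_addN.

Fact loc_mulA : associative loc_mul.
Proof.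
move=> x y z; have [a [s [Ps ->]]] := fracW x; have [b [t [Pt ->]]] := fracW y.
have [c [u [Pu ->]]] := fracW z; rewrite !loc_mulE; apply: fracE; ring.
Qed.

Fact loc_mulC : commutative loc_mul.
Proof.
move=> x y; have [a [s [Ps ->]]] := fracW x; have [b [t [Pt ->]]] := fracW y.
rewrite !loc_mulE; apply: fracE; ring.
Qed.

Fact loc_mul1 : left_id (frac 1 spec_one) loc_mul.
Proof.
move=> x; have [a [s [Ps ->]]] := fracW x; rewrite loc_mulE; apply: fracE; ring.
Qed.

Fact loc_mulD : left_distributive loc_mul loc_add.
Proof.
move=> x y z; have [a [s [Ps ->]]] := fracW x; have [b [t [Pt ->]]] := fracW y.
have [c [u [Pu ->]]] := fracW z; rewrite !(loc_mulE, loc_addE).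
apply: fracE; ring.
Qed.

HB.instance Definition _ := GRing.Zmodule_isComPzRing.Build localization
  loc_mulA loc_mulC loc_mul1 loc_mulD.

Lemma fracD a s (Ps : ~ P s) b t (Pt : ~ P t) :
  frac a Ps + frac b Pt = frac (a * t + b * s) (spec_mul Ps Pt).
Proof. exact: loc_addE. Qed.

Lemma fracN a s (Ps : ~ P s) : - frac a Ps = frac (- a) Ps.
Proof. exact: loc_oppE. Qed.

Lemma fracM a s (Ps : ~ P s) b t (Pt : ~ P t) :
  frac a Ps * frac b Pt = frac (a * b) (spec_mul Ps Pt).
Proof. exact: loc_mulE. Qed.

End Localization.

Record opens (X : topologicalType) := Opens {
  oset :> set X;
  openP : open oset }.

Definition opensI (X : topologicalType) (U V : opens X) : opens X :=
  Opens (openI (openP U) (openP V)).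

Lemma opensIl (X : topologicalType) (U V : opens X) : opensI U V `<=` U.
Proof. by move=> x []. Qed.

Lemma opensIr (X : topologicalType) (U V : opens X) : opensI U V `<=` V.
Proof. by move=> x []. Qed.

Definition opensT (X : topologicalType) : opens X := Opens (@openT X).

Definition opens_preim (X Y : topologicalType) (f : X -> Y) (fc : continuous f)
    (V : opens Y) : opens X :=
  Opens ((continuousP f).1 fc V (openP V)).

Record ringedSpace := RingedSpace {
  carrier :> topologicalType;
  sect : opens carrier -> comPzRingType;
  res : forall U V : opens carrier, V `<=` U -> {rmorphism sect U -> sect V};
  res_id : forall (U : opens carrier) (h : U `<=` U) (s : sect U), res h s = s;
  res_comp : forall (U V W : opens carrier) (h : V `<=` U) (k : W `<=` V)
    (l : W `<=` U) (s : sect U), res k (res h s) = res l s;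
  sheaf_inj : forall (I : Type) (U : opens carrier) (F : I -> opens carrier)
    (h : forall i, F i `<=` U), U `<=` \bigcup_i F i ->
    forall s t : sect U, (forall i, res (h i) s = res (h i) t) -> s = t;
  sheaf_glue : forall (I : Type) (U : opens carrier) (F : I -> opens carrier)
    (h : forall i, F i `<=` U), U `<=` \bigcup_i F i ->
    forall s : (forall i, sect (F i)),
    (forall i j, res (@opensIl _ (F i) (F j)) (s i) =
       res (@opensIr _ (F i) (F j)) (s j)) ->
    exists t, forall i, res (h i) t = s i }.

Arguments res {r U V}.
Arguments res_comp {r U V W}.

Section Stalk.
Variables (X : ringedSpace) (x : X).

Record pregerm := PreGerm {
  pg_dom : opens X;
  pg_mem : pg_dom x;
  pg_sec : sect pg_dom }.

HB.instance Definition _ := gen_eqMixin pregerm.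
HB.instance Definition _ := gen_choiceMixin pregerm.

Definition germ_eq (a b : pregerm) := `[< exists (W : opens X)
  (h : W `<=` pg_dom a) (k : W `<=` pg_dom b),
  W x /\ res h (pg_sec a) = res k (pg_sec b) >].

Lemma germ_eq_refl : reflexive germ_eq.
Proof.
move=> a; apply/asboolP; exists (pg_dom a), (@subset_refl _ _), (@subset_refl _ _).
by split=> //; exact: pg_mem.
Qed.

Lemma germ_eq_sym : symmetric germ_eq.
Proof.
suff H a b : germ_eq a b -> germ_eq b a by move=> a b; apply/idP/idP; exact: H.
by move/asboolP=> [W [h [k [Wx e]]]]; apply/asboolP; exists W, k, h.
Qed.

Lemma germ_eq_trans : transitive germ_eq.
Proof.
move=> b a c /asboolP[W [h [k [Wx e]]]] /asboolP[W' [h' [k' [W'x e']]]].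
apply/asboolP; pose Z := opensI W W'.
have l : Z `<=` W by exact: opensIl.
have r : Z `<=` W' by exact: opensIr.
have ha := subset_trans l h; have hc := subset_trans r k'.
have hb := subset_trans l k.
exists Z, ha, hc; split => //.
rewrite -(res_comp h l) e (res_comp _ _ hb) -(res_comp k' r) -e'.
by rewrite (res_comp _ _ hb).
Qed.

Canonical germ_equiv := EquivRel germ_eq germ_eq_refl germ_eq_sym germ_eq_trans.

Definition stalk := {eq_quot germ_equiv}.

HB.instance Definition _ := Choice.on stalk.

Definition germ (U : opens X) (Ux : U x) (s : sect U) : stalk :=
  \pi_stalk (PreGerm Ux s).

Lemma germ_eqP (U V : opens X) (Ux : U x) (Vx : V x) (s : sect U) (t : sect V) :
  (exists (W : opens X) (h : W `<=` U) (k : W `<=` V),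
     W x /\ res h s = res k t) <-> germ Ux s = germ Vx t.
Proof.
split=> [h|/eqmodP /asboolP//].
by apply/eqmodP/asboolP.
Qed.

Lemma germ_res (U V : opens X) (Ux : U x) (Vx : V x) (h : V `<=` U)
  (s : sect U) : germ Vx (res h s) = germ Ux s.
Proof.
by apply/germ_eqP; exists V, (@subset_refl _ _), h; rewrite res_id.
Qed.

Lemma germW (a : stalk) : exists (U : opens X) (Ux : U x) s, a = germ Ux s.
Proof.
exists (pg_dom (repr a)), (pg_mem (repr a)), (pg_sec (repr a)).
by rewrite /germ; case: (repr a) (reprK a).
Qed.

Lemma germW2 (a b : stalk) : exists (U : opens X) (Ux : U x) s t,
  a = germ Ux s /\ b = germ Ux t.
Proof.
have [U [Ux [s ->]]] := germW a; have [V [Vx [t ->]]] := germW b.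
have l : opensI U V `<=` U by exact: opensIl.
have r : opensI U V `<=` V by exact: opensIr.
have Wx : opensI U V x by [].
by exists (opensI U V), Wx, (res l s), (res r t); rewrite !germ_res.
Qed.

Lemma germW3 (a b c : stalk) : exists (U : opens X) (Ux : U x) s t u,
  [/\ a = germ Ux s, b = germ Ux t & c = germ Ux u].
Proof.
have [U [Ux [s [t [-> ->]]]]] := germW2 a b; have [V [Vx [u ->]]] := germW c.
have l : opensI U V `<=` U by exact: opensIl.
have r : opensI U V `<=` V by exact: opensIr.
have Wx : opensI U V x by [].
by exists (opensI U V), Wx, (res l s), (res l t), (res r u); rewrite !germ_res.
Qed.

Definition stalk_op2 (op : forall U : opens X, sect U -> sect U -> sect U)
    (a b : stalk) : stalk :=
  let U := pg_dom (repr a) in let V := pg_dom (repr b) in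
  @germ (opensI U V) (conj (pg_mem (repr a)) (pg_mem (repr b)))
    (op _ (res (@opensIl _ U V) (pg_sec (repr a)))
          (res (@opensIr _ U V) (pg_sec (repr b)))).

Lemma germ_repr (U : opens X) (Ux : U x) (s : sect U) :
  exists (W : opens X) (h : W `<=` pg_dom (repr (germ Ux s))) (k : W `<=` U),
     W x /\ res h (pg_sec (repr (germ Ux s))) = res k s.
Proof.
apply: (germ_eqP (pg_mem (repr (germ Ux s))) Ux _ _).2.
by rewrite -[RHS]reprK /germ; case: (repr _).
Qed.

Lemma stalk_op2E op :
  (forall (U V : opens X) (h : V `<=` U) s t,
     res h (op U s t) = op V (res h s) (res h t)) ->
  forall (U : opens X) (Ux : U x) (s t : sect U),
  stalk_op2 op (germ Ux s) (germ Ux t) = germ Ux (op U s t).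
Proof.
move=> opN U Ux s t; rewrite /stalk_op2.
have [V [h [k [Vx e]]]] := germ_repr Ux s.
have [W [h' [k' [Wx e']]]] := germ_repr Ux t.
move: (repr (germ Ux s)) (repr (germ Ux t)) h h' e e'.
move=> [V0 V0x s0] [W0 W0x t0] /= h h' e e'.
pose Z := opensI V W.
have l : Z `<=` V by exact: opensIl.
have r : Z `<=` W by exact: opensIr.
have ZU := subset_trans l k.
have Z0 : Z `<=` opensI V0 W0 by move=> y [Vy Wy]; split; [exact: (h y)|exact: (h' y)].
apply/germ_eqP; exists Z, Z0, ZU; split=> //; rewrite !opN.
rewrite !(res_comp _ _ (subset_trans l h)) !(res_comp _ _ (subset_trans r h')).
rewrite -(res_comp h l) e -(res_comp h' r) e' (res_comp _ _ ZU).
by rewrite (res_comp _ _ ZU).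
Qed.

Definition stalk_add := stalk_op2 (fun U s t => s + t).
Definition stalk_mul := stalk_op2 (fun U s t => s * t).
Definition stalk_opp (a : stalk) : stalk :=
  germ (pg_mem (repr a)) (- pg_sec (repr a)).

Lemma stalk_addE (U : opens X) (Ux : U x) (s t : sect U) :
  stalk_add (germ Ux s) (germ Ux t) = germ Ux (s + t).
Proof. by rewrite /stalk_add stalk_op2E // => *; rewrite rmorphD. Qed.

Lemma stalk_mulE (U : opens X) (Ux : U x) (s t : sect U) :
  stalk_mul (germ Ux s) (germ Ux t) = germ Ux (s * t).
Proof. by rewrite /stalk_mul stalk_op2E // => *; rewrite rmorphM. Qed.

Lemma stalk_oppE (U : opens X) (Ux : U x) (s : sect U) :
  stalk_opp (germ Ux s) = germ Ux (- s).
Proof.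
rewrite /stalk_opp; have [V [h [k [Vx e]]]] := germ_repr Ux s.
move: (repr (germ Ux s)) h e => [V0 V0x s0] /= h e.
by apply/germ_eqP; exists V, h, k; split=> //; rewrite !rmorphN e.
Qed.

Definition stalk0 : stalk := @germ (opensT X) I 0.
Definition stalk1 : stalk := @germ (opensT X) I 1.

Lemma stalk0E (U : opens X) (Ux : U x) : stalk0 = germ Ux 0.
Proof. by rewrite /stalk0 -(germ_res (U := opensT X) I Ux (@subsetT _ _)) rmorph0. Qed.

Lemma stalk1E (U : opens X) (Ux : U x) : stalk1 = germ Ux 1.
Proof. by rewrite /stalk1 -(germ_res (U := opensT X) I Ux (@subsetT _ _)) rmorph1. Qed.

Fact stalk_addA : associative stalk_add.
Proof.
move=> a b c; have [U [Ux [s [t [u [-> -> ->]]]]]] := germW3 a b c.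
by rewrite !stalk_addE addrA.
Qed.

Fact stalk_addC : commutative stalk_add.
Proof.
move=> a b; have [U [Ux [s [t [-> ->]]]]] := germW2 a b.
by rewrite !stalk_addE addrC.
Qed.

Fact stalk_add0 : left_id stalk0 stalk_add.
Proof.
move=> a; have [U [Ux [s ->]]] := germW a.
by rewrite (stalk0E Ux) stalk_addE add0r.
Qed.

Fact stalk_addN : left_inverse stalk0 stalk_opp stalk_add.
Proof.
move=> a; have [U [Ux [s ->]]] := germW a.
by rewrite (stalk0E Ux) stalk_oppE stalk_addE addNr.
Qed.

HB.instance Definition _ := GRing.isZmodule.Build stalk
  stalk_addA stalk_addC stalk_add0 stalk_addN.

Fact stalk_mulA : associative stalk_mul.
Proof.
move=> a b c; have [U [Ux [s [t [u [-> -> ->]]]]]] := germW3 a b c.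
by rewrite !stalk_mulE mulrA.
Qed.

Fact stalk_mulC : commutative stalk_mul.
Proof.
move=> a b; have [U [Ux [s [t [-> ->]]]]] := germW2 a b.
by rewrite !stalk_mulE mulrC.
Qed.

Fact stalk_mul1 : left_id stalk1 stalk_mul.
Proof.
move=> a; have [U [Ux [s ->]]] := germW a.
by rewrite (stalk1E Ux) stalk_mulE mul1r.
Qed.

Fact stalk_mulD : left_distributive stalk_mul stalk_add.
Proof.
move=> a b c; have [U [Ux [s [t [u [-> -> ->]]]]]] := germW3 a b c.
by rewrite !(stalk_mulE, stalk_addE) mulrDl.
Qed.

HB.instance Definition _ := GRing.Zmodule_isComPzRing.Build stalk
  stalk_mulA stalk_mulC stalk_mul1 stalk_mulD.

Fact germ_is_zmod_morphism (U : opens X) (Ux : U x) : zmod_morphism (germ Ux).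
Proof.
move=> s t; rewrite -stalk_addE -stalk_oppE; reflexivity.
Qed.

Fact germ_is_monoid_morphism (U : opens X) (Ux : U x) :
  monoid_morphism (germ Ux).
Proof.
split=> [|s t]; first by rewrite -stalk1E.
by rewrite -stalk_mulE.
Qed.

HB.instance Definition _ (U : opens X) (Ux : U x) :=
  GRing.isZmodMorphism.Build (sect U) stalk (germ Ux) (germ_is_zmod_morphism Ux).
HB.instance Definition _ (U : opens X) (Ux : U x) :=
  GRing.isMonoidMorphism.Build (sect U) stalk (germ Ux)
    (germ_is_monoid_morphism Ux).

End Stalk.

(* pull_local says that the maps induced on stalks are local homomorphisms, so
   that between locally ringed spaces these are exactly the morphisms of locally
   ringed spaces. *)

Record morphism (X Y : ringedSpace) := Morphism {
  mfun :> X -> Y;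
  mcont : continuous mfun;
  pull : forall V : opens Y, {rmorphism sect V -> sect (opens_preim mcont V)};
  pull_res : forall (U V : opens Y) (h : V `<=` U)
    (k : opens_preim mcont V `<=` opens_preim mcont U) (s : sect U),
    pull V (res h s) = res k (pull U s);
  pull_local : forall (x : X) (V : opens Y) (Vx : V (mfun x)) (s : sect V),
    is_unit (@germ X x (opens_preim mcont V) Vx (pull V s)) ->
    is_unit (germ Vx s) }.

(* The preimages of V under f and g are only propositionally equal, so that
   sections are compared after restriction. *)
Definition mor_eq (X Y : ringedSpace) (f g : morphism X Y) :=
  f =1 g /\
  forall (V : opens Y) (W : opens X) (h : W `<=` opens_preim (@mcont _ _ f) V)
    (k : W `<=` opens_preim (@mcont _ _ g) V) (s : sect V),
  res h (pull f V s) = res k (pull g V s).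

Section Composition.
Variables X Y Z : ringedSpace.

Lemma id_cont : continuous (@id X).
Proof. by move=> x; exact: cvg_id. Qed.

Definition id_sub (V : opens X) : opens_preim id_cont V `<=` V :=
  fun x Vx => Vx.

Fact id_pull_res (U V : opens X) (h : V `<=` U)
  (k : opens_preim id_cont V `<=` opens_preim id_cont U) (s : sect U) :
  res (@id_sub V) (res h s) = res k (res (@id_sub U) s).
Proof. by rewrite !(res_comp _ _ (subset_trans k (@id_sub U))). Qed.

Fact id_pull_local (x : X) (V : opens X) (Vx : V x) (s : sect V) :
  is_unit (@germ X x (opens_preim id_cont V) Vx (res (@id_sub V) s)) ->
  is_unit (germ Vx s).
Proof. by rewrite germ_res. Qed.

Definition mor_id : morphism X X := Morphism id_pull_res id_pull_local.

Variables (g : morphism Y Z) (f : morphism X Y).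

Lemma comp_cont : continuous (g \o f).
Proof. by move=> x; apply: continuous_comp; exact: mcont. Qed.

Definition comp_sub (V : opens Z) :
  opens_preim comp_cont V `<=`
    opens_preim (@mcont _ _ f) (opens_preim (@mcont _ _ g) V) :=
  fun x Vx => Vx.

Definition comp_pull (V : opens Z) :
    {rmorphism sect V -> sect (opens_preim comp_cont V)} :=
  res (@comp_sub V) \o pull f _ \o pull g V.

Fact comp_pull_res (U V : opens Z) (h : V `<=` U)
  (k : opens_preim comp_cont V `<=` opens_preim comp_cont U) (s : sect U) :
  comp_pull V (res h s) = res k (comp_pull U s).
Proof.
rewrite /comp_pull /=.
have k1 : opens_preim (@mcont _ _ g) V `<=` opens_preim (@mcont _ _ g) U.
  by move=> y; exact: h.
have k2 : opens_preim (@mcont _ _ f) (opens_preim (@mcont _ _ g) V) `<=`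
          opens_preim (@mcont _ _ f) (opens_preim (@mcont _ _ g) U).
  by move=> y; exact: h.
rewrite (pull_res h k1) (pull_res k1 k2).
by rewrite !(res_comp _ _ (subset_trans (@comp_sub V) k2)).
Qed.

Fact comp_pull_local (x : X) (V : opens Z) (Vx : V (g (f x))) (s : sect V) :
  is_unit (@germ X x (opens_preim comp_cont V) Vx (comp_pull V s)) ->
  is_unit (germ Vx s).
Proof.
rewrite /comp_pull /=.
rewrite (@germ_res X x (opens_preim (@mcont _ _ f) (opens_preim (@mcont _ _ g) V))).
by move=> /pull_local/pull_local.
Qed.

Definition mor_comp : morphism X Z :=
  @Morphism X Z (g \o f) comp_cont comp_pull comp_pull_res comp_pull_local.

End Composition.

Definition isomorphic (X Y : ringedSpace) :=
  exists (f : morphism X Y) (g : morphism Y X),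
    mor_eq (mor_comp g f) (mor_id X) /\ mor_eq (mor_comp f g) (mor_id Y).

(* j is an isomorphism of Z onto its image, which is open in X and carries the
   restriction of the structure sheaf of X. *)
Definition open_immersion (Z X : ringedSpace) (j : morphism Z X) :=
  [/\ injective j, forall W : set Z, open W -> open (j @` W)
    & forall V : opens X, V `<=` range j -> bijective (pull j V)].

(* The last clause is the surjectivity of the map of sheaves on X. *)
Definition closed_immersion (Z X : ringedSpace) (j : morphism Z X) :=
  [/\ injective j, forall W : set Z, closed W -> closed (j @` W)
    & forall (V : opens X) (s : sect (opens_preim (@mcont _ _ j) V)) (x : X),
      V x ->
      exists (W : opens X) (t : sect W)
        (h : opens_preim (@mcont _ _ j) W `<=` opens_preim (@mcont _ _ j) V),
      [/\ W x, W `<=` V & pull j W t = res h s]].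

Section Spec.
Variable A : comPzRingType.
Let X := spec_pt A.

HB.instance Definition _ := gen_eqMixin X.
HB.instance Definition _ := gen_choiceMixin X.

(* the closed sets are the V(E) = {P | E `<=` P} *)
Definition spec_open : set_system X :=
  [set U | exists E : set A, U = [set P : X | ~ (E `<=` P)]].

Lemma spec_openT : spec_open setT.
Proof.
exists setT; apply/esym; rewrite -subTset => P _ /(_ 1 I); exact: spec_one.
Qed.

Lemma spec_openI : setI_closed spec_open.
Proof.
move=> _ _ [E ->] [F ->]; exists [set a * b | a in E & b in F].
apply/seteqP; split=> P /=.
  move=> [/existsNP[a /not_implyP[Ea Pa]] /existsNP[b /not_implyP[Fb Pb]]] EF.
  by apply: (spec_mul Pa Pb); apply: EF; exists a => //; exists b.
move=> EF; have [[_ PM _ PI] _ _] := spec_prime P.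
split=> S; apply: EF => _ [a Ea [b Fb <-]].
  by rewrite mulrC; apply: PI => //; exact: S.
by apply: PI => //; exact: S.
Qed.

Lemma spec_open_bigU (I : Type) (f : I -> set X) :
  (forall i, spec_open (f i)) -> spec_open (\bigcup_i f i).
Proof.
move=> /choice[E fE]; exists (\bigcup_i E i).
apply/seteqP; split=> P /=.
  move=> [i _]; rewrite fE /= => h k; apply: h => a Ea.
  by apply: k; exists i.
move=> /existsNP[a /not_implyP[[i _ Ea] Pa]]; exists i => //.
by rewrite fE /= => /(_ _ Ea).
Qed.

HB.instance Definition _ :=
  isOpenTopological.Build X spec_openT spec_openI spec_open_bigU.

(* families of elements of the A_P, P in U, which are locally fractions *)
Definition locally_frac (U : opens X)
    (s : forall P : X, U P -> localization P) :=
  forall (P : X), U P -> exists (V : opens X) (a f : A),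
  [/\ V P, V `<=` U & forall (Q : X) (UQ : U Q), V Q ->
    exists Qf : ~ Q f, s Q UQ = frac a Qf].

Record spec_sect (U : opens X) := SpecSect {
  spec_fun :> forall P : X, U P -> localization P;
  spec_funP : locally_frac spec_fun }.

Lemma spec_sect_eq (U : opens X) (s t : spec_sect U) :
  (forall P UP, s P UP = t P UP) -> s = t.
Proof.
case: s t => [s sP] [t tP] /= e.
have st : s = t by apply/functional_extensionality_dep => P;
  apply/functional_extensionality_dep => UP; exact: e.
by move: sP; rewrite st => sP; congr SpecSect; exact: Prop_irrelevance.
Qed.

Section SectRing.
Variable U : opens X.

HB.instance Definition _ := gen_eqMixin (spec_sect U).
HB.instance Definition _ := gen_choiceMixin (spec_sect U).

Fact const_locally_frac (a : A) :
  locally_frac (fun (P : X) (_ : U P) => frac a (@spec_one A P)).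
Proof.
move=> P UP; exists U, a, 1; split=> // Q UQ _.
by exists (@spec_one A Q).
Qed.

Definition spec_const (a : A) : spec_sect U := SpecSect (const_locally_frac a).

Fact add_locally_frac (s t : spec_sect U) :
  locally_frac (fun (P : X) (UP : U P) => s P UP + t P UP).
Proof.
move=> P UP; have [V [a [f [VP VU sE]]]] := spec_funP s UP.
have [W [b [g [WP _ tE]]]] := spec_funP t UP.
exists (opensI V W), (a * g + b * f), (f * g); split=> //.
  by move=> Q [/VU].
move=> Q UQ [VQ WQ]; have [Qf ->] := sE Q UQ VQ; have [Qg ->] := tE Q UQ WQ.
by exists (spec_mul Qf Qg); rewrite fracD.
Qed.

Fact opp_locally_frac (s : spec_sect U) :
  locally_frac (fun (P : X) (UP : U P) => - s P UP).
Proof.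
move=> P UP; have [V [a [f [VP VU sE]]]] := spec_funP s UP.
exists V, (- a), f; split=> // Q UQ VQ; have [Qf ->] := sE Q UQ VQ.
by exists Qf; rewrite fracN.
Qed.

Fact mul_locally_frac (s t : spec_sect U) :
  locally_frac (fun (P : X) (UP : U P) => s P UP * t P UP).
Proof.
move=> P UP; have [V [a [f [VP VU sE]]]] := spec_funP s UP.
have [W [b [g [WP _ tE]]]] := spec_funP t UP.
exists (opensI V W), (a * b), (f * g); split=> //.
  by move=> Q [/VU].
move=> Q UQ [VQ WQ]; have [Qf ->] := sE Q UQ VQ; have [Qg ->] := tE Q UQ WQ.
by exists (spec_mul Qf Qg); rewrite fracM.
Qed.

Definition spec_add s t := SpecSect (@add_locally_frac s t).
Definition spec_opp s := SpecSect (@opp_locally_frac s).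
Definition spec_mulf s t := SpecSect (@mul_locally_frac s t).

Fact spec_addA : associative spec_add.
Proof. by move=> r s t; apply: spec_sect_eq => P UP /=; rewrite addrA. Qed.
Fact spec_addC : commutative spec_add.
Proof. by move=> s t; apply: spec_sect_eq => P UP /=; rewrite addrC. Qed.
Fact spec_add0 : left_id (spec_const 0) spec_add.
Proof. by move=> s; apply: spec_sect_eq => P UP; exact: add0r. Qed.
Fact spec_addN : left_inverse (spec_const 0) spec_opp spec_add.
Proof. by move=> s; apply: spec_sect_eq => P UP; exact: addNr. Qed.

HB.instance Definition _ := GRing.isZmodule.Build (spec_sect U)
  spec_addA spec_addC spec_add0 spec_addN.

Fact spec_mulA : associative spec_mulf.
Proof. by move=> r s t; apply: spec_sect_eq => P UP /=; rewrite mulrA. Qed.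
Fact spec_mulC : commutative spec_mulf.
Proof. by move=> s t; apply: spec_sect_eq => P UP /=; rewrite mulrC. Qed.
Fact spec_mul1 : left_id (spec_const 1) spec_mulf.
Proof. by move=> s; apply: spec_sect_eq => P UP; exact: mul1r. Qed.
Fact spec_mulD : left_distributive spec_mulf spec_add.
Proof. by move=> r s t; apply: spec_sect_eq => P UP; exact: mulrDl. Qed.

HB.instance Definition _ := GRing.Zmodule_isComPzRing.Build (spec_sect U)
  spec_mulA spec_mulC spec_mul1 spec_mulD.

End SectRing.

Section Restriction.
Variables (U V : opens X) (h : V `<=` U).

Fact res_locally_frac (s : spec_sect U) :
  locally_frac (fun (P : X) (VP : V P) => s P (h VP)).
Proof.
move=> P VP; have [W [a [f [WP WU sE]]]] := spec_funP s (h VP).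
exists (opensI W V), a, f; split=> //; first exact: opensIr.
by move=> Q VQ [WQ _]; exact: sE.
Qed.

Definition spec_res (s : spec_sect U) : spec_sect V :=
  SpecSect (@res_locally_frac s).

Fact spec_res_zmod : zmod_morphism spec_res.
Proof. by move=> s t; apply: spec_sect_eq. Qed.
Fact spec_res_monoid : monoid_morphism spec_res.
Proof. by split=> [|s t]; apply: spec_sect_eq. Qed.

HB.instance Definition _ :=
  GRing.isZmodMorphism.Build (spec_sect U) (spec_sect V) spec_res spec_res_zmod.
HB.instance Definition _ :=
  GRing.isMonoidMorphism.Build (spec_sect U) (spec_sect V) spec_res
    spec_res_monoid.

End Restriction.

Definition Spec : ringedSpace.
Proof.
apply: (@RingedSpace X (fun U => spec_sect U)
  (fun U V h => (spec_res h : {rmorphism spec_sect U -> spec_sect V}))).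
- move=> U h s; apply: spec_sect_eq => P UP /=.
  by congr (spec_fun s _); exact: Prop_irrelevance.
- move=> U V W h k l s; apply: spec_sect_eq => P WP /=.
  by congr (spec_fun s _); exact: Prop_irrelevance.
- move=> I U F h cov s t e; apply: spec_sect_eq => P UP.
  have [i _ FP] := cov P UP.
  have := congr1 (fun r : spec_sect (F i) => r P FP) (e i) => /=.
  by rewrite (Prop_irrelevance (h i P FP) UP).
- move=> I U F h cov s e.
  have /choice[c cP] (Q : {P : X | U P}) : exists i, F i (sval Q).
    by case: Q => P UP /=; have [i _ FP] := cov P UP; exists i.
  pose t (P : X) (UP : U P) : localization P :=
    s (c (exist _ P UP)) P (cP (exist _ P UP)).
  have tE i P (UP : U P) (FP : F i P) : t P UP = s i P FP.
    set j := c (exist _ P UP).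
    have := congr1 (fun r : spec_sect (opensI (F j) (F i)) =>
      r P (conj (cP (exist _ P UP)) FP)) (e j i) => /= {}e.
    rewrite /t -/j (Prop_irrelevance (cP _) (opensIl (conj (cP (exist _ P UP)) FP))).
    by rewrite e; congr (spec_fun _ _); exact: Prop_irrelevance.
  have tP : locally_frac t.
    move=> P UP; have [i _ FP] := cov P UP.
    have [V [a [f [VP VF sE]]]] := spec_funP (s i) FP.
    exists V, a, f; split=> //; first exact: subset_trans VF (h i).
    move=> Q UQ VQ; have FQ : F i Q by exact: VF VQ.
    by have [Qf sQ] := sE Q FQ VQ; exists Qf; rewrite (tE i _ _ FQ).
  exists (SpecSect tP) => i; apply: spec_sect_eq => P FP; exact: tE.
Defined.

End Spec.

(* the image of a under the map A -> O_{X,x} induced by f *)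
Definition structure_map (A : comPzRingType) (X : ringedSpace)
    (f : morphism X (Spec A)) (x : X) (a : A) : stalk x :=
  let c : @sect (Spec A) (opensT (Spec A)) := spec_const (opensT (Spec A)) a in
  @germ X x (opens_preim (@mcont _ _ f) (opensT (Spec A))) I (pull f _ c).

Definition affine_open (X : ringedSpace) (U : opens X) :=
  exists (A : comPzRingType) (j : morphism (Spec A) X),
    open_immersion j /\ range j = U.

Definition is_scheme (X : ringedSpace) :=
  forall x : X, exists2 U : opens X, U x & affine_open U.

Definition is_integral (X : ringedSpace) :=
  [set: X] !=set0 /\
  forall U : opens X, U !=set0 -> is_domain (sect U).

Definition finite_type (X S : ringedSpace) (f : morphism X S) :=
  exists (I : Type) (V : I -> opens S), \bigcup_i V i = setT /\
  forall i, affine_open (V i) /\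
  exists (n : nat) (U : 'I_n -> opens X),
    f @^-1` V i = \bigcup_k U k /\
    forall k, affine_open (U k) /\
    exists h : U k `<=` opens_preim (@mcont _ _ f) (V i),
    finite_type_hom (fun s : sect (V i) => res h (pull f (V i) s)).

Definition fibre_product (X Y S P : ringedSpace) (f : morphism X S)
    (g : morphism Y S) (p : morphism P X) (q : morphism P Y) :=
  [/\ is_scheme P, mor_eq (mor_comp f p) (mor_comp g q)
    & forall (T : ringedSpace) (a : morphism T X) (b : morphism T Y),
      is_scheme T -> mor_eq (mor_comp f a) (mor_comp g b) ->
      exists u : morphism T P,
      [/\ mor_eq (mor_comp p u) a, mor_eq (mor_comp q u) b
        & forall v : morphism T P, mor_eq (mor_comp p v) a ->
            mor_eq (mor_comp q v) b -> mor_eq v u]].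

(* The fibre product X x_S X and the diagonal are given by their universal
   properties, and are thus determined up to isomorphism. *)
Definition separated (X S : ringedSpace) (f : morphism X S) :=
  exists (P : ringedSpace) (p q : morphism P X) (diag : morphism X P),
  [/\ fibre_product f f p q, mor_eq (mor_comp p diag) (mor_id X),
      mor_eq (mor_comp q diag) (mor_id X) & closed_immersion diag].

Definition generic_point (X : ringedSpace) (eta : X) :=
  closure [set eta] = setT.

Section Models.
Variables (D : idomainType) (K : fieldType) (iota : {rmorphism D -> K}).
Implicit Types (R S A P V : set K) (Y : set (set K)).

Definition has_frac_field R :=
  forall x : K, exists a b, [/\ R a, R b, b != 0 & x = a / b].

(* L(K/D); D is identified with its image under iota *)
Definition local_domains : set (set K) :=
  [set R | [/\ is_local R, range iota `<=` R & has_frac_field R]].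

Definition dominates S R := R `<=` S /\
  exists MS MR, [/\ is_maximal S MS, is_maximal R MR & MR = MS `&` R].

Definition is_valuation_ring V :=
  is_subring V /\ forall x : K, x != 0 -> V x \/ V x^-1.

Definition is_premodel Y := Y !=set0 /\ Y `<=` local_domains.

Definition irredundant Y := forall R S V, Y R -> Y S -> is_valuation_ring V ->
  dominates V R -> dominates V S -> R = S.

Definition is_affine_ring A := exists s : seq K,
  A = smallest (@is_subring K) (range iota `|` [set` s]).

Definition localize A P : set K :=
  [set x | exists a s, [/\ A a, A s, ~ P s & x = a / s]].

Definition localizations A : set (set K) :=
  [set R | exists2 P, is_prime A P & R = localize A P].

Definition is_model Y := [/\ is_premodel Y, irredundant Y
  & exists (n : nat) (E : 'I_n -> set K), (forall e, is_affine_ring (E e)) /\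
    Y = \bigcup_e localizations (E e)].

Record model := Model { mset :> set (set K); modelP : is_model mset }.

Lemma smallest_subring (G : set K) :
  is_subring (smallest (@is_subring K) G).
Proof.
split=> [M [[]]//|x y hx hy M MG|x y hx hy M MG];
  have [[_ MB MM] _] := MG; [exact: MB (hx _ MG) (hy _ MG)|].
exact: MM (hx _ MG) (hy _ MG).
Qed.

Lemma model_setT (Y : model) : Y setT.
Proof.
have [[[R YR] Ysub] _ [n [E [Eaff YE]]]] := modelP Y.
move: (YR); rewrite YE => -[e _ [P Pp _]]; exists e => //.
have [s Es] := Eaff e.
have [E1 EB EM] : is_subring (E e) by rewrite Es; exact: smallest_subring.
have E0 : E e 0 by rewrite -(subrr 1); exact: EB.
have p0 : is_prime (E e) [set 0].
  split=> /=; last 2 first.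
  - exact/eqP/oner_neq0.
  - by move=> x y _ _ /eqP; rewrite mulf_eq0 => /orP[]/eqP; [left|right].
  - split=> [x ->//|//|x y -> ->|r x _ ->]; [exact: addr0|exact: mulr0].
exists [set 0] => //.
have Y0 : Y (localize (E e) [set 0]) by rewrite YE; exists e => //; exists [set 0].
have [_ _ Yfrac] := Ysub _ Y0.
apply/esym; rewrite -subTset => x _.
have [_ [_ [[a [s' [Ea Es' s'0 ->]]] [b [t [Eb Et t0 ->]]] bt0 ->]]] := Yfrac x.
exists (a * t), (s' * b); split; [exact: EM|exact: EM| |].
  move=> /eqP; rewrite mulf_eq0 => /orP[/eqP//|/eqP b0].
  by move: bt0; rewrite b0 mul0r eqxx.
have s'z : s' != 0 by apply/eqP.
have tz : t != 0 by apply/eqP.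
have bz : b != 0 by apply: contra bt0 => /eqP->; rewrite mul0r.
by field; rewrite s'z tz bz.
Qed.

Section ModelSpace.
Variable Y : model.

Record model_pt := ModelPt { pt_ring :> set K; pt_in : Y pt_ring }.

HB.instance Definition _ := gen_eqMixin model_pt.
HB.instance Definition _ := gen_choiceMixin model_pt.

(* unions of the sets {R in Y | H `<=` R}, H finite *)
Definition model_open : set_system model_pt :=
  [set U | forall R : model_pt, U R -> exists2 H : seq K, [set` H] `<=` R
     & forall S : model_pt, [set` H] `<=` S -> U S].

Lemma model_openT : model_open setT.
Proof. by move=> R _; exists [::] => // x. Qed.

Lemma model_openI : setI_closed model_open.
Proof.
move=> U V oU oV R [/oU[H HR HU] /oV[G GR GV]].
exists (H ++ G) => [x /=|S HGS].
  by rewrite mem_cat => /orP[/HR|/GR].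
by split; [apply: HU|apply: GV] => x /= xH; apply: HGS;
  rewrite /= mem_cat xH ?orbT.
Qed.

Lemma model_open_bigU (I : Type) (f : I -> set model_pt) :
  (forall i, model_open (f i)) -> model_open (\bigcup_i f i).
Proof.
move=> of_ R [i _ /of_[H HR HU]]; exists H => // S HS.
by exists i => //; exact: HU.
Qed.

HB.instance Definition _ :=
  isOpenTopological.Build model_pt model_openT model_openI model_open_bigU.

(* The intersection of the R in U if U is nonempty, and {0} otherwise. *)
Definition model_ring (U : opens model_pt) : set K :=
  [set x | (oset U = set0 -> x = 0) /\ forall R : model_pt, U R -> R x].

Record model_sect (U : opens model_pt) := ModelSect {
  sect_val :> K;
  sect_valP : model_ring U sect_val }.

Lemma model_sect_inj U : injective (@sect_val U).
Proof.
move=> [x xP] [y yP] /= e; move: xP; rewrite e => xP.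
by congr ModelSect; exact: Prop_irrelevance.
Qed.

Lemma pt_subring (R : model_pt) : is_subring R.
Proof. by have [[_ /(_ _ (pt_in R))[[]]]] := modelP Y. Qed.

Section SectRing.
Variable U : opens model_pt.

HB.instance Definition _ := gen_eqMixin (model_sect U).
HB.instance Definition _ := gen_choiceMixin (model_sect U).

Fact msect0P : model_ring U 0.
Proof.
split=> // R _; have [R1 RB _] := pt_subring R.
by rewrite -(subrr 1); exact: RB.
Qed.

Fact msect_oppP (x : model_sect U) : model_ring U (- sect_val x).
Proof.
have [x0 xR] := sect_valP x; split=> [/x0->|R UR]; first exact: oppr0.
have [R1 RB _] := pt_subring R.
by rewrite -sub0r -{1}(subrr 1); apply: (RB); [exact: RB|exact: xR].
Qed.

Fact msect_addP (x y : model_sect U) : model_ring U (sect_val x + sect_val y).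
Proof.
have [x0 xR] := sect_valP x; have [y0 yR] := msect_oppP y.
have [y0' _] := sect_valP y.
split=> [U0|R UR]; first by rewrite x0 // y0' // addr0.
rewrite -[sect_val y]opprK; have [_ RB _] := pt_subring R.
by apply: RB; [exact: xR|exact: yR].
Qed.

Fact msect_mulP (x y : model_sect U) : model_ring U (sect_val x * sect_val y).
Proof.
have [x0 xR] := sect_valP x; have [_ yR] := sect_valP y.
split=> [/x0->|R UR]; first exact: mul0r.
have [_ _ RM] := pt_subring R.
by apply: RM; [exact: xR|exact: yR].
Qed.

Fact msect1P : model_ring U (if `[< oset U = set0 >] then 0 else 1).
Proof.
case: asboolP => [U0|U0]; first exact: msect0P.
by split=> // R _; have [] := pt_subring R.
Qed.

Definition msect0 := ModelSect msect0P.
(* the unit of the zero ring {0} is 0 *)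
Definition msect1 := ModelSect msect1P.
Definition msect_opp x := ModelSect (msect_oppP x).
Definition msect_add x y := ModelSect (msect_addP x y).
Definition msect_mul x y := ModelSect (msect_mulP x y).

Fact msect_addA : associative msect_add.
Proof. by move=> x y z; apply: model_sect_inj => /=; rewrite addrA. Qed.
Fact msect_addC : commutative msect_add.
Proof. by move=> x y; apply: model_sect_inj => /=; rewrite addrC. Qed.
Fact msect_add0 : left_id msect0 msect_add.
Proof. by move=> x; apply: model_sect_inj => /=; rewrite add0r. Qed.
Fact msect_addN : left_inverse msect0 msect_opp msect_add.
Proof. by move=> x; apply: model_sect_inj => /=; rewrite addNr. Qed.

HB.instance Definition _ := GRing.isZmodule.Build (model_sect U)
  msect_addA msect_addC msect_add0 msect_addN.

Fact msect_mulA : associative msect_mul.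
Proof. by move=> x y z; apply: model_sect_inj => /=; rewrite mulrA. Qed.
Fact msect_mulC : commutative msect_mul.
Proof. by move=> x y; apply: model_sect_inj => /=; rewrite mulrC. Qed.
Fact msect_mul1 : left_id msect1 msect_mul.
Proof.
move=> x; apply: model_sect_inj => /=.
have [x0 _] := sect_valP x.
by case: asboolP => [/x0->|_]; rewrite ?mulr0 ?mul1r.
Qed.
Fact msect_mulD : left_distributive msect_mul msect_add.
Proof. by move=> x y z; apply: model_sect_inj => /=; rewrite mulrDl. Qed.

HB.instance Definition _ := GRing.Zmodule_isComPzRing.Build (model_sect U)
  msect_mulA msect_mulC msect_mul1 msect_mulD.

End SectRing.

Section Restriction.
Variables (U V : opens model_pt) (h : V `<=` U).

Fact mresP (x : model_sect U) :
  model_ring V (if `[< oset V = set0 >] then 0 else sect_val x).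
Proof.
case: asboolP => [V0|V0]; first exact: msect0P.
by split=> // R VR; have [_ xR] := sect_valP x; exact: xR (h VR).
Qed.

(* the inclusion if V is nonempty, and the zero map otherwise *)
Definition mres (x : model_sect U) : model_sect V := ModelSect (mresP x).

Fact mres_zmod : zmod_morphism mres.
Proof.
move=> x y; apply: model_sect_inj => /=.
by case: asboolP; rewrite ?subrr.
Qed.

Fact mres_monoid : monoid_morphism mres.
Proof.
split=> [|x y]; apply: model_sect_inj => /=; case: asboolP; rewrite ?mulr0 //.
case: asboolP => // U0 V0; case: V0.
by rewrite -subset0 -U0.
Qed.

HB.instance Definition _ :=
  GRing.isZmodMorphism.Build (model_sect U) (model_sect V) mres mres_zmod.
HB.instance Definition _ :=
  GRing.isMonoidMorphism.Build (model_sect U) (model_sect V) mres mres_monoid.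

End Restriction.

Lemma model_open_setT (U : opens model_pt) : oset U <> set0 ->
  U (ModelPt (model_setT Y)).
Proof.
move=> /eqP/set0P[R UR]; have /(_ R UR)[H _ HU] := openP U.
exact: HU.
Qed.

Definition model_space : ringedSpace.
Proof.
apply: (@RingedSpace model_pt (fun U => model_sect U)
  (fun (U V : opens model_pt) h =>
    (mres h : {rmorphism model_sect U -> model_sect V}))).
- move=> U h s; apply: model_sect_inj => /=.
  by case: asboolP => // U0; have [/(_ U0)] := sect_valP s.
- move=> U V W h k l s; apply: model_sect_inj => /=.
  case: asboolP => // W0; case: asboolP => // V0; case: W0.
  by rewrite -subset0 -V0.
- move=> I U F h cov s t e; apply: model_sect_inj.
  have [U0|U0] := pselect (oset U = set0).
    have [/(_ U0)-> _] := sect_valP s; by have [/(_ U0)-> _] := sect_valP t.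
  have [i _ Fi] := cov _ (model_open_setT U0).
  have := congr1 (@sect_val _) (e i) => /=.
  by case: asboolP => // Fi0; move: Fi; rewrite Fi0.
- move=> I U F h cov s e.
  have [U0|U0] := pselect (oset U = set0).
    exists (0 : model_sect U) => i; apply: model_sect_inj => /=.
    have Fi0 : oset (F i) = set0 by rewrite -subset0 -U0.
    by have [/(_ Fi0)-> _] := sect_valP (s i); case: asboolP.
  have [i _ Fi] := cov _ (model_open_setT U0).
  have sE j : oset (F j) <> set0 -> sect_val (s j) = sect_val (s i).
    move=> /model_open_setT Fj.
    have := congr1 (@sect_val _) (e j i) => /=.
    by case: asboolP => // /seteqP[/(_ _ (conj Fj Fi))].
  have tP : model_ring U (sect_val (s i)).
    split=> // R UR; have [j _ Fj] := cov R UR.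
    rewrite -(sE j); last by move=> Fj0; move: Fj; rewrite Fj0.
    by have [_] := sect_valP (s j); exact.
  exists (ModelSect tP) => j; apply: model_sect_inj => /=.
  case: asboolP => [Fj0|/sE//].
  by have [/(_ Fj0)->] := sect_valP (s j).
Defined.

End ModelSpace.

End Models.

(* Main.v *)
(* Identify the function field of X with K.  Each point x has a local ring R_x
   in K, and Y is the set of these rings.  On an affine chart Spec A -> X the
   ring A embeds in K and the R_x are exactly its localizations, so that
   O(U) is the intersection of the R_x, x in U.  Since Spec D is quasi-compact,
   finitely many charts whose rings have the form D[1/g, s_1, ..., s_n] suffice.
   If a subring S of K with a prime Q dominates both R_x and R_y, then Spec S
   has two morphisms to X over D that agree at the generic point and send Q to
   x and y respectively;
     the diagonal being closed, x = y.  For S a valuation ring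
   this is irredundance, for S = R_x = R_y it is the injectivity of x |-> R_x,
   and for S = R_y dominating the localization of a chart it is the openness of
   this map. *)

(* Sections are handled through their values in K, the images under [phi] of their germs at eta. A
   section is determined by its value ([sect_uniq]), every element of the intersection of the R_x is
   such a value ([sect_glue]), and the units of a stalk are read off from values ([germ_unit_ev]);
   no isomorphism between a stalk and R_x has to be built.

   The fibre product in the definition of separatedness is known only by its universal property, so
   its points cannot be described. Its existence half combines two morphisms from Spec S into one
   map u; its uniqueness half, applied over Spec K, puts the image under u of the generic point of
   Spec S on the diagonal, and closedness does the rest.

   Openness of x |-> R_x is where finite generation over D matters: that R_y contains the ring E of
   a chart is a condition on finitely many elements, hence open in the model. It does not by itself
   place y in the chart. But R_y then dominates a localization of E, which is R_w for some w in the
   chart, and separatedness gives y = w. *)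
From HB Require Import structures.
From mathcomp Require Import all_boot all_order all_algebra.
From mathcomp Require Import ring.
From mathcomp Require Import all_classical topology_structure.
Require Import Defs.

Set Implicit Arguments.
Unset Strict Implicit.
Unset Printing Implicit Defensive.

Import GRing.Theory.

Local Open Scope ring_scope.
Local Open Scope classical_set_scope.

(** * Prime ideals and local subrings of a field *)

Section PrimeIdeals.
Variable A : comPzRingType.

Lemma ideal_adjoin (J : set A) (x : A) : is_ideal setT J ->
  is_ideal setT [set j + a * x | j in J & a in setT].
Proof.
move=> [_ J0 JD JM]; split=> //.
- by exists 0 => //; exists 0 => //; rewrite mul0r addr0.
- move=> _ _ [j Jj [a _ <-]] [k Jk [b _ <-]].
  by exists (j + k); [exact: JD|exists (a + b) => //; ring].
- move=> r _ _ [j Jj [a _ <-]].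
  by exists (r * j); [exact: JM|exists (r * a) => //; ring].
Qed.

(** An ideal that is maximal among those containing I and avoiding the multiplicative set S is
    prime. *)
Lemma exists_prime (I S : set A) : is_ideal setT I -> S 1 ->
    (forall x y, S x -> S y -> S (x * y)) -> (forall x, I x -> ~ S x) ->
  exists P : spec_pt A, I `<=` P /\ forall x, P x -> ~ S x.
Proof.
move=> iI S1 SM IS.
pose F (J : set A) := (forall x, J x -> ~ S x) /\
  (J = set0 \/ is_ideal setT J /\ I `<=` J).
have [G GF Gtot|J [[JS J0] Jmax]] := @Zorn_bigcup _ F.
  split=> [x [J GJ Jx]|]; first by have [h _] := GF _ GJ; exact: h.
  have [G0|/existsNP[J0 /not_implyP[GJ0 J0n]]] :=
    pselect (forall J, G J -> J = set0).
    by left; rewrite -subset0 => x [J /G0->].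
  have idl J : G J -> J <> set0 -> is_ideal setT J /\ I `<=` J.
    by move=> /GF[_ []].
  have idx J x : G J -> J x -> is_ideal setT J.
    by move=> GJ Jx; have [|//] := idl J GJ; move=> Je; rewrite Je in Jx.
  right; have [[_ J00 _ _] IJ0] := idl _ GJ0 J0n.
  split; last by move=> x /IJ0; exists J0.
  split=> //; first by exists J0.
    move=> x y [J GJ Jx] [L GL Ly].
    have [_ _ JD _] := idx _ _ GJ Jx; have [_ _ LD _] := idx _ _ GL Ly.
    have [/(_ _ Jx) Lx|/(_ _ Ly) Jy] := Gtot _ _ GJ GL.
      by exists L => //; exact: LD.
    by exists J => //; exact: JD.
  move=> r x _ [J GJ Jx]; exists J => //.
  by have [_ _ _ JM] := idx _ _ GJ Jx; exact: JM.
have FI : F I by split=> //; right; split.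
have I0 : I 0 by case: iI.
have {J0}[J0|[iJ IJ]] := J0.
  by case: (Jmax I _ FI); rewrite J0; split=> [x []|/(_ 0 I0)].
(* By maximality, adjoining any x outside J produces an element of S. If neither x nor y were in J,
   the product of two such elements would lie in both J and S. *)
have big x : ~ J x -> exists j a, J j /\ S (j + a * x).
  move=> Jx; apply: contrapT => h.
  pose L := [set j + a * x | j in J & a in setT].
  have JL : J `<=` L.
    by move=> j Jj; exists j => //; exists 0 => //; rewrite mul0r addr0.
  apply: (Jmax L).
    split=> // LJ; apply: Jx; apply: LJ.
    by exists 0; [case: iJ|exists 1 => //; rewrite mul1r add0r].
  split; last by right; split; [exact: ideal_adjoin|exact: subset_trans JL].
  move=> _ [j Jj [a _ <-]] Ss; by apply: h; exists j, a.
suff Jp : is_prime setT J by exists (SpecPt Jp).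
split=> // [/JS//|x y _ _ Jxy].
apply: contrapT => /not_orP[/big[j [a [Jj Sj]]] /big[k [b [Jk Sk]]]].
apply: (JS _ _ (SM _ _ Sj Sk)); have [_ _ JD JM] := iJ.
have -> : (j + a * x) * (k + b * y) =
  (k + b * y) * j + ((a * x) * k + (a * b) * (x * y)) by ring.
by apply: (JD); [exact: JM|apply: JD; exact: JM].
Qed.

(** [exists_prime] with S = {1}. It serves as a local-to-global principle: I is an annihilator or an
    ideal of denominators, and one suitable element outside each prime suffices. *)
Lemma unit_ideal (I : set A) : is_ideal setT I ->
  (forall P : spec_pt A, exists2 x, I x & ~ P x) -> I 1.
Proof.
move=> iI h; apply: contrapT => I1.
have [//|x y -> -> /=|x Ix /= x1|P [IP _]] := @exists_prime I [set 1] iI.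
- exact: mulr1.
- by apply: I1; rewrite -x1.
- by have [x /IP Px] := h P.
Qed.

(** [exists_prime] for the powers of g: a prime that avoids them lies in D(g). *)
Lemma radical_ideal (I : set A) (g : A) : is_ideal setT I ->
  (forall P : spec_pt A, ~ P g -> exists2 x, I x & ~ P x) ->
  exists n, I (g ^+ n).
Proof.
move=> iI h; apply: contrapT => In.
have [|_ _ [n _ <-] [m _ <-]|x Ix [n _ gx]|P [IP PS]] :=
  @exists_prime I (range (fun n => g ^+ n)) iI.
- by exists 0%N.
- by exists (n + m)%N => //; rewrite exprD.
- by apply: In; exists n; rewrite gx.
- have [|x /IP//] := h P.
  by move=> Pg; apply: (PS _ Pg); exists 1%N.
Qed.

End PrimeIdeals.

Section Subrings.
Variable K : fieldType.
Implicit Types (R E P Q M : set K).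

Lemma subring0 R : is_subring R -> R 0.
Proof. by move=> [R1 RB _]; rewrite -(subrr 1); exact: RB. Qed.

Lemma subringN R x : is_subring R -> R x -> R (- x).
Proof.
by move=> sR Rx; have [_ RB _] := sR; rewrite -sub0r; apply: (RB) => //;
  exact: subring0.
Qed.

Lemma subringD R x y : is_subring R -> R x -> R y -> R (x + y).
Proof.
move=> sR Rx Ry; have [_ RB _] := sR; rewrite -(opprK y).
by apply: RB => //; exact: subringN.
Qed.

Lemma subringM R x y : is_subring R -> R x -> R y -> R (x * y).
Proof. by move=> [_ _ RM]; exact: RM. Qed.

Lemma subringX R x n : is_subring R -> R x -> R (x ^+ n).
Proof.
move=> sR Rx; elim: n => [|n IH]; first by rewrite expr0; case: sR.
by rewrite exprS; exact: subringM.
Qed.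

(** As 0^-1 is 0, which lies in R, the condition on the inverse is an implication: it keeps 0 among
    the nonunits. *)
Definition nonunits R : set K := [set x | R x /\ (R x^-1 -> x = 0)].

Lemma nonunitsN1 R : is_subring R -> ~ nonunits R 1.
Proof.
by move=> [R1 _ _] [_]; rewrite invr1 => /(_ R1)/eqP; rewrite oner_eq0.
Qed.

Lemma nonunitsPn R x : R x -> ~ nonunits R x -> x != 0 /\ R x^-1.
Proof.
move=> Rx /not_andP[//|/not_implyP[Rx' /eqP]]; by [].
Qed.

(** A proper ideal consists of nonunits, so once these form an ideal it is the only maximal one.
    This makes the maximal ideals in [dominates] explicit. *)
Lemma nonunits_max R M : is_subring R -> is_ideal R (nonunits R) ->
  is_maximal R M <-> M = nonunits R.
Proof.
move=> sR iN.
have sub I : is_ideal R I -> ~ I 1 -> I `<=` nonunits R.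
  move=> [IR I0 ID IM] I1 x Ix; split; first exact: IR.
  move=> Rx; apply/eqP; apply: contra_notT I1 => x0.
  by rewrite -(mulVf x0); exact: IM.
split=> [[iM M1 Mmax]|->].
  by apply/esym/Mmax => //; [exact: nonunitsN1|exact: sub].
split=> // [|I iI I1 NI]; first exact: nonunitsN1.
by apply/seteqP; split=> //; exact: sub.
Qed.

Lemma nonunits_local R : is_subring R -> is_ideal R (nonunits R) -> is_local R.
Proof.
move=> sR iN; split=> //; exists (nonunits R); split.
  exact/(nonunits_max _ sR iN).
by move=> M /(nonunits_max _ sR iN).
Qed.

Lemma nonunits_prime R : is_subring R -> is_ideal R (nonunits R) ->
  is_prime R (nonunits R).
Proof.
move=> sR iN; split=> // [|x y Rx Ry]; first exact: nonunitsN1.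
move=> [_ xy];
  apply: contrapT => /not_orP[/(nonunitsPn Rx)[x0 Rx'] /(nonunitsPn Ry)[y0
    Ry']].
have /eqP : x * y = 0 by apply: xy; rewrite invfM; exact: subringM.
by rewrite mulf_eq0 (negPf x0) (negPf y0).
Qed.

(** For the sum of two nonzero nonunits, one of them divides the other in R, so the sum is a
    multiple of a nonunit. *)
Lemma valuation_nonunits R : is_valuation_ring R -> is_ideal R (nonunits R).
Proof.
move=> [sR V]; have mulN r x : R r -> nonunits R x -> nonunits R (r * x).
  move=> Rr [Rx Nx]; split; first exact: subringM.
  move=> Rrx; apply/eqP; have [->|r0] := eqVneq r 0; first by rewrite mul0r.
  rewrite mulf_eq0 (negPf r0) /=; apply/eqP/Nx.
  have -> : x^-1 = r * (r * x)^-1 by rewrite invfM mulrA mulfV // mul1r.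
  exact: subringM.
split=> //.
- by move=> x [].
- by split=> //; exact: subring0.
move=> x y Nx Ny; have [[Rx xu] [Ry yu]] := (Nx, Ny).
have [x0|x0] := eqVneq x 0; first by rewrite x0 add0r.
have [y0|y0] := eqVneq y 0; first by rewrite y0 addr0.
have R1 : R 1 by case: sR.
have /V : x / y != 0 by rewrite mulf_neq0 ?invr_eq0.
case=> [Rxy|]; last rewrite invfM invrK => Rxy.
  have -> : x + y = (x / y + 1) * y by field.
  by apply: mulN => //; exact: subringD.
have -> : x + y = (1 + x^-1 * y) * x by field.
by apply: mulN => //; exact: subringD.
Qed.

Lemma prime_neq0 E P s : is_prime E P -> ~ P s -> s != 0.
Proof. by move=> [[_ P0 _ _] _ _] Ps; apply/eqP => s0; rewrite s0 in Ps. Qed.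

Lemma prime_notM E P s t : is_prime E P -> E s -> E t -> ~ P s -> ~ P t ->
  ~ P (s * t).
Proof. by move=> [_ _ Pp] Es Et Ps Pt /(Pp _ _ Es Et)[]. Qed.

Section Localize.
Variables E P : set K.
Hypotheses (sE : is_subring E) (pP : is_prime E P).

Lemma sub_localize : E `<=` localize E P.
Proof.
move=> x Ex; exists x, 1; split=> //; [by case: sE|by case: pP|].
by rewrite divr1.
Qed.

Lemma localize_subring : is_subring (localize E P).
Proof.
split.
- by apply: sub_localize; case: sE.
- move=> _ _ [a [s [Ea Es Ps ->]]] [b [t [Eb Et Pt ->]]].
  have [_ EB EM] := sE.
  exists (a * t - b * s), (s * t); split.
  + by apply: (EB); exact: EM.
  + exact: EM.
  + exact: prime_notM pP _ _ _ _.
  + by field; rewrite (prime_neq0 pP Ps) (prime_neq0 pP Pt).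
- move=> _ _ [a [s [Ea Es Ps ->]]] [b [t [Eb Et Pt ->]]].
  have [_ EB EM] := sE.
  exists (a * b), (s * t); split; [exact: EM|exact: EM| |].
  + exact: prime_notM pP _ _ _ _.
  + by field; rewrite (prime_neq0 pP Ps) (prime_neq0 pP Pt).
Qed.

Lemma nonunits_localizeE :
  nonunits (localize E P) = [set x | exists a s, [/\ P a, E s, ~ P s & x = a /
    s]].
Proof.
have [[PE P0 _ PM] P1 Pp] := pP; have [E1 EB EM] := sE.
apply/seteqP; split=> x.
  move=> [[a [s [Ea Es Ps xE]]] xu]; exists a, s; split=> //.
  apply: contrapT => Pa; have a0 := prime_neq0 pP Pa.
  have s0 := prime_neq0 pP Ps.
  have /xu /eqP : localize E P x^-1.
    by exists s, a; split=> //; rewrite xE invfM invrK mulrC.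
  by rewrite xE mulf_eq0 invr_eq0 (negPf a0) (negPf s0).
move=> [a [s [Pa Es Ps ->]]]; split; first by exists a, s; split=> //;
  exact: PE.
move=> [b [t [Eb Et Pt e]]].
have [->|a0] := eqVneq a 0; first by rewrite mul0r.
have s0 := prime_neq0 pP Ps; have t0 := prime_neq0 pP Pt.
exfalso; apply: (prime_notM pP Es Et Ps Pt).
have -> : s * t = b * a; last exact: PM.
move: e; rewrite invfM invrK => e.
have -> : s * t = (a^-1 * s) * (a * t) by field.
by rewrite e; field.
Qed.

Lemma localize_nonunits_ideal :
  is_ideal (localize E P) (nonunits (localize E P)).
Proof.
have [[PE P0 PD PM] P1 Pp] := pP; have [E1 EB EM] := sE.
split.
- by move=> x [].
- by split=> //; apply: sub_localize; exact: PE.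
- rewrite nonunits_localizeE => _ _ [a [s [Pa Es Ps ->]]] [b [t [Pb Et Pt ->]]].
  exists (a * t + b * s), (s * t); split.
  + by rewrite [a * t]mulrC [b * s]mulrC; apply: PD; exact: PM.
  + exact: EM.
  + exact: prime_notM pP _ _ _ _.
  + by field; rewrite (prime_neq0 pP Ps) (prime_neq0 pP Pt).
- rewrite nonunits_localizeE => _ _ [b [t [Eb Et Pt ->]]] [a [s [Pa Es Ps ->]]].
  exists (b * a), (t * s); split; [exact: PM|exact: EM| |].
  + exact: prime_notM pP _ _ _ _.
  + by field; rewrite (prime_neq0 pP Ps) (prime_neq0 pP Pt).
Qed.

Lemma nonunits_localizeI : nonunits (localize E P) `&` E = P.
Proof.
have [[PE P0 PD PM] P1 Pp] := pP; have [E1 EB EM] := sE.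
apply/seteqP; split=> x.
  rewrite nonunits_localizeE => -[[a [s [Pa Es Ps xE]]] Ex].
  have [|//|//] := Pp x s Ex Es.
  by rewrite xE divfK //; exact: prime_neq0 pP Ps.
move=> Px; split; last exact: PE.
by rewrite nonunits_localizeE; exists x, 1; split=> //; rewrite divr1.
Qed.

End Localize.

Lemma prime_restrict R E Q : is_subring E -> E `<=` R -> is_prime R Q ->
  is_prime E (Q `&` E).
Proof.
move=> sE ER [[QR Q0 QD QM] Q1 Qp]; split; [split| |].
- by move=> x [].
- by split=> //; exact: subring0.
- by move=> x y [Qx Ex] [Qy Ey]; split; [exact: QD|exact: subringD].
- by move=> r x Er [Qx Ex]; split; [apply: QM => //; exact: ER|exact: subringM].
- by move=> [].
- by move=> x y Ex Ey [/(Qp _ _ (ER _ Ex) (ER _ Ey))[]]; [left|right].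
Qed.

(** Elements of E' are fractions over E with denominators outside Q. For s outside Q the numerator
    of s is outside Q as well, so a / s is again a fraction over E. This compares a chart ring with
    its localization E[1/g]. *)
Lemma localize_intermediate E E' Q : is_subring E -> is_subring E' ->
    E `<=` E' -> is_prime E' Q -> E' `<=` localize E (Q `&` E) ->
  localize E' Q = localize E (Q `&` E).
Proof.
move=> sE sE' EE' pQ E'l; have pP := prime_restrict sE EE' pQ.
apply/seteqP; split=> x; last first.
  move=> [a [s [Ea Es Ps ->]]]; exists a, s; split=> //; try exact: EE'.
  by move=> Qs; apply: Ps.
move=> [a [s [E'a E's Qs ->]]].
have [a1 [t1 [Ea1 Et1 Pt1 aE]]] := E'l _ E'a.
have [s1 [t2 [Es1 Et2 Pt2 sE'']]] := E'l _ E's.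
have Qt1 : ~ Q t1 by move=> Qt1; apply: Pt1.
have Qt2 : ~ Q t2 by move=> Qt2; apply: Pt2.
have t10 := prime_neq0 pQ Qt1; have t20 := prime_neq0 pQ Qt2.
have s0 := prime_neq0 pQ Qs.
have Qs1 : ~ Q s1.
  have -> : s1 = s * t2 by rewrite sE'' divfK.
  by apply: (prime_notM pQ) => //; exact: EE'.
have s10 := prime_neq0 pQ Qs1.
exists (a1 * t2), (t1 * s1); split; [exact: subringM|exact: subringM| |].
  by move=> [+ _]; apply: (prime_notM pQ) => //; exact: EE'.
by rewrite aE sE''; field; rewrite t10 t20 s10.
Qed.

End Subrings.

Section SubringType.
Variable K : fieldType.

Record subring := Subring {
  subring_set :> set K;
  subringP : is_subring subring_set }.

Variable R : subring.

Definition subring_pred : {pred K} := [pred x | `[< R x >]].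

Fact subring_pred_closed : subring_closed subring_pred.
Proof.
have [R1 RB RM] := subringP R.
split=> [|x y /asboolP Rx /asboolP Ry|x y /asboolP Rx /asboolP Ry];
  apply/asboolP => //.
  exact: RB.
exact: RM.
Qed.

Definition subring_type := {x : K | x \in subring_pred}.

HB.instance Definition _ := SubChoice.on subring_type.
HB.instance Definition _ := GRing.SubChoice_isSubComPzRing.Build K subring_pred
  subring_type subring_pred_closed.

End SubringType.

(** [Spec] needs a ring type. The subset R is therefore replaced by an abstract ring with an
    embedding [sigma] into K, the form in which subrings enter all statements about morphisms. *)
Lemma subring_ring (K : fieldType) (R : set K) : is_subring R ->
  exists (S : comPzRingType) (sigma : {rmorphism S -> K}),
    injective sigma /\ range sigma = R.
Proof.
move=> sR; exists (subring_type (Subring sR)), (val : {rmorphism _ -> _}).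
split; first exact: val_inj.
apply/seteqP; split=> [_ [[x Rx] _ <-]|x /asboolP Rx]; first exact/asboolP.
by exists (exist _ x Rx : subring_type (Subring sR)).
Qed.

(** An element of E outside the centre of S on E is invertible in S. Hence the localization of E at
    the centre lies in S, and S dominates it. *)
Lemma localize_dominated (K : fieldType) (S E : set K) : is_subring S ->
    is_ideal S (nonunits S) -> is_subring E -> E `<=` S ->
  localize E (nonunits S `&` E) `<=` S /\
  nonunits (localize E (nonunits S `&` E)) =
    nonunits S `&` localize E (nonunits S `&` E).
Proof.
move=> sS iN sE ES; have pN := nonunits_prime sS iN.
have pQ := prime_restrict sE ES pN; have [_ _ _ NM] := iN.
have inv s : E s -> ~ (nonunits S `&` E) s -> s != 0 /\ S s^-1.
  by move=> Es Qs; apply: nonunitsPn; [exact: ES|move=> Ns; apply: Qs].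
split=> [_ [a [s [Ea Es /(inv _ Es)[s0 Ss] ->]]]|].
  by apply: (subringM sS) => //; exact: ES.
apply/seteqP; split=> x.
  move=> Nx; split; last by case: Nx.
  move: Nx;
    rewrite nonunits_localizeE // => -[a [s [[Na Ea] Es /(inv _ Es)[s0 Ss]
      ->]]].
  by rewrite mulrC; exact: NM.
rewrite nonunits_localizeE // => -[Nx [a [s [Ea Es Qs xE]]]].
exists a, s; split=> //; split=> //; have [s0 _] := inv _ Es Qs.
have -> : a = s * x by rewrite xE mulrC divfK.
by apply: NM => //; exact: ES.
Qed.

(** * Ringed spaces *)

Section RingedSpaces.

Lemma unit_cancel (A : comPzRingType) (u x y : A) : is_unit u ->
  x * u = y * u -> x = y.
Proof.
move=> [v uv] e; rewrite -[x]mulr1 -[y]mulr1 -uv !mulrA e //.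
Qed.

Lemma germ_unitP (X : ringedSpace) (x : X) (U : opens X) (Ux : U x) (s : sect
  U) :
  is_unit (germ Ux s) <-> exists (W : opens X) (h : W `<=` U) (t : sect W),
    W x /\ res h s * t = 1.
Proof.
split=> [[y]|[W [h [t [Wx e]]]]]; last first.
  by exists (germ Wx t); rewrite -(germ_res Ux Wx h) -rmorphM e rmorph1.
have [V [Vx [t ->]]] := germW y.
have l : opensI U V `<=` U by exact: opensIl.
have r : opensI U V `<=` V by exact: opensIr.
have Wx : opensI U V x by [].
rewrite -(germ_res Ux Wx l) -(germ_res Vx Wx r) -rmorphM.
rewrite -[RHS](rmorph1 (germ Wx)) => /germ_eqP[Z [h [k [Zx]]]].
rewrite rmorphM !rmorph1 => e.
exists Z, (subset_trans k l), (res h (res r t)); split=> //; rewrite -e.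
by congr (_ * _); rewrite !(res_comp _ _ (subset_trans k l)).
Qed.

(** The open sets on which s and t agree cover U; the sheaf axiom is applied to the family of all of
    them. *)
Lemma germ_sep (X : ringedSpace) (U : opens X) (s t : sect U) :
  (forall x (Ux : U x), germ Ux s = germ Ux t) -> s = t.
Proof.
move=> e; pose I := {V : opens X | exists h : V `<=` U, res h s = res h t}.
have IU (i : I) : sval i `<=` U by case: (svalP i).
apply: (@sheaf_inj X I U (fun V => sval V) IU).
  move=> x Ux; have /germ_eqP[W [h [k [Wx eW]]]] := e x Ux.
  rewrite (Prop_irrelevance k h) in eW.
  by exists (exist _ W (ex_intro _ h eW)).
by move=> i; have [h eV] := svalP i; rewrite (Prop_irrelevance (IU i) h).
Qed.

Lemma pull_germ_unit (X Y : ringedSpace) (f : morphism X Y) (x : X)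
    (V : opens Y) (Vx : V (f x)) (s : sect V) :
  is_unit (@germ X x (opens_preim (@mcont _ _ f) V) Vx (pull f V s)) <->
  is_unit (germ Vx s).
Proof.
split; first exact: pull_local.
move=> /germ_unitP[W [h [t [Wx e]]]]; apply/germ_unitP.
have k : opens_preim (@mcont _ _ f) W `<=` opens_preim (@mcont _ _ f) V.
  by move=> y; exact: h.
exists (opens_preim (@mcont _ _ f) W), k, (pull f W t); split=> //.
by rewrite -(pull_res h k) -rmorphM e rmorph1.
Qed.

Lemma res_res (X : ringedSpace) (U V W : opens X) (h : V `<=` U) (k : W `<=` V)
  (s : sect U) : res k (res h s) = res (subset_trans k h) s.
Proof. exact: res_comp. Qed.

Lemma res_irr (X : ringedSpace) (U V : opens X) (h k : V `<=` U) (s : sect U) :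
  res h s = res k s.
Proof. by rewrite (Prop_irrelevance h k). Qed.

Variables X Y Z T : ringedSpace.

Lemma mor_eq_trans (g f h : morphism X Y) :
  mor_eq f g -> mor_eq g h -> mor_eq f h.
Proof.
move=> [e es] [e' es']; split=> [x|V W k l s]; first by rewrite e e'.
have m : W `<=` opens_preim (@mcont _ _ g) V.
  by move=> x /k /=; rewrite /preimage /mkset /= e.
by rewrite (es V W k m) (es' V W m l).
Qed.

Lemma pull_comp (g : morphism Y Z) (f : morphism X Y) (V : opens Z) (s : sect
  V) :
  pull (mor_comp g f) V s = res (@comp_sub _ _ _ g f V) (pull f _ (pull g V s)).
Proof. by []. Qed.

Lemma pull_id (V : opens X) (s : sect V) :
  pull (mor_id X) V s = res (@id_sub _ V) s.
Proof. by []. Qed.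

Lemma mor_comp_idl (f : morphism X Y) : mor_eq (mor_comp (mor_id Y) f) f.
Proof.
split=> // V W h k s; rewrite /= /comp_pull /=.
have m : opens_preim (@mcont _ _ f) (opens_preim (@id_cont Y) V) `<=`
  opens_preim (@mcont _ _ f) V by [].
rewrite (pull_res _ m) !res_res; exact: res_irr.
Qed.

Lemma mor_comp_assoc (f : morphism Z T) (g : morphism Y Z) (h : morphism X Y) :
  mor_eq (mor_comp f (mor_comp g h)) (mor_comp (mor_comp f g) h).
Proof.
split=> // V W k l s; rewrite /= /comp_pull /=.
have m : opens_preim (@mcont _ _ h) (opens_preim (@comp_cont _ _ _ f g) V) `<=`
  opens_preim (@mcont _ _ h) (opens_preim (@mcont _ _ g) (opens_preim (@mcont _
    _ f) V)).
  by [].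
rewrite (pull_res _ m) !res_res; exact: res_irr.
Qed.

Lemma mor_comp_eql (f g : morphism Y Z) (h : morphism X Y) :
  mor_eq f g -> mor_eq (mor_comp f h) (mor_comp g h).
Proof.
move=> [e es]; split=> [x|V W k l s]; first exact: e.
rewrite /= /comp_pull /=.
have m : opens_preim (@mcont _ _ f) V `<=` opens_preim (@mcont _ _ g) V.
  by move=> y; rewrite /= /preimage /mkset e.
pose fV := opens_preim (@mcont _ _ f) V.
have n : opens_preim (@mcont _ _ h) fV `<=`
  opens_preim (@mcont _ _ h) (opens_preim (@mcont _ _ g) V) by move=> y;
    exact: m.
have := es V fV (@subset_refl _ _) m s; rewrite res_id => ->.
rewrite (pull_res _ n) !res_res; exact: res_irr.
Qed.

Lemma open_immersion_id : open_immersion (mor_id X).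
Proof.
split=> //; first by move=> W; rewrite image_id.
move=> V _; have r : V `<=` opens_preim (@id_cont X) V by [].
by exists (res r) => s; rewrite /= res_res res_id.
Qed.

End RingedSpaces.

(** The universal property of a fibre product quantifies over schemes only; this makes it applicable
    to morphisms out of a spectrum. *)
Lemma scheme_Spec (A : comPzRingType) : is_scheme (Spec A).
Proof.
move=> P; exists (opensT (Spec A)) => //; exists A, (mor_id _).
split; first exact: open_immersion_id.
by apply/seteqP; split=> // Q _; exists Q.
Qed.

(** * Spectra *)

Section SpecSections.
Variable A : comPzRingType.

Fact basic_open_subproof (g : A) : open [set P : Spec A | ~ spec_ideal P g].
Proof.
exists [set g]; apply/seteqP; split=> P /= Pg; first by move=> /(_ g erefl).
by move=> Pg'; apply: Pg => _ ->.
Qed.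

Definition basic_open (g : A) : opens (Spec A) := Opens (basic_open_subproof g).

Lemma basic_open_base (U : opens (Spec A)) (P : Spec A) : U P ->
  exists2 g, ~ spec_ideal P g & basic_open g `<=` U.
Proof.
have [E UE] := openP U; rewrite UE => /existsNP[g /not_implyP[Eg Pg]].
by exists g => // Q /= Qg /(_ g Eg).
Qed.

Lemma idealMl (P : spec_pt A) (s t : A) : P t -> P (s * t).
Proof. by case: (spec_prime P) => -[_ _ _ PM] _ _; exact: PM. Qed.

Lemma ideal0 (P : spec_pt A) : P 0.
Proof. by case: (spec_prime P) => -[]. Qed.

Lemma frac_unit (P : spec_pt A) (a f : A) (Pf : ~ P f) :
  is_unit (frac a Pf) <-> ~ P a.
Proof.
split=> [[y]|Pa]; last first.
  by exists (frac f Pa); rewrite fracM; apply: fracE; ring.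
have [b [c [Pc ->]]] := fracW y; rewrite fracM => /frac_eqP[u Pu].
rewrite mulr1 mul1r => e Pa; apply: (spec_mul Pu (spec_mul Pf Pc)).
have -> : u * (f * c) = (u * b) * a by apply/eqP; rewrite -subr_eq0 -oppr_eq0; 
  apply/eqP; rewrite -[RHS]e; ring.
exact: idealMl.
Qed.

Definition spec_val (U : opens (Spec A)) (s : sect U) (P : Spec A) (UP : U P)
  : localization P := spec_fun s UP.

Lemma spec_val_inj (U : opens (Spec A)) (s t : sect U) :
  (forall P (UP : U P), spec_val s UP = spec_val t UP) -> s = t.
Proof. exact: spec_sect_eq. Qed.

Lemma spec_val_irr (U : opens (Spec A)) (s : sect U) (P : Spec A)
  (h k : U P) : spec_val s h = spec_val s k.
Proof. by congr (spec_val s _); exact: Prop_irrelevance. Qed.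

Lemma spec_val_res (U V : opens (Spec A)) (h : V `<=` U) (s : sect U)
    (P : Spec A) (VP : V P) (UP : U P) :
  spec_val (res h s) VP = spec_val s UP.
Proof. by rewrite (spec_val_irr s UP (h P VP)). Qed.

Lemma spec_valM (U : opens (Spec A)) (s t : sect U) (P : Spec A) (UP : U P) :
  spec_val (s * t) UP = spec_val s UP * spec_val t UP.
Proof. by []. Qed.

Lemma spec_val1 (U : opens (Spec A)) (P : Spec A) (UP : U P) :
  spec_val (1 : sect U) UP = 1.
Proof. by []. Qed.

Lemma spec_val_germ (U V : opens (Spec A)) (s : sect U) (t : sect V)
    (P : Spec A) (UP : U P) (VP : V P) :
  germ UP s = germ VP t -> spec_val s UP = spec_val t VP.
Proof.
move=> /germ_eqP[W [h [k [WP e]]]].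
by rewrite -(spec_val_res h s WP) e (spec_val_res k).
Qed.

Lemma spec_valW (U : opens (Spec A)) (s : sect U) (P : Spec A) (UP : U P) :
  exists (V : opens (Spec A)) (a f : A), [/\ V P, V `<=` U &
    forall (Q : Spec A) (UQ : U Q), V Q ->
    exists Qf : ~ spec_ideal Q f, spec_val s UQ = frac a Qf].
Proof. exact: spec_funP. Qed.

Definition frac_sect (a f : A) (V : opens (Spec A))
    (h : V `<=` basic_open f) : @sect (Spec A) V.
Proof.
apply: (@SpecSect A V (fun P VP => frac a (h P VP))).
move=> P VP; exists V, a, f; split=> // Q UQ _; by exists (h Q UQ).
Defined.

Lemma frac_sectE (a f : A) (V : opens (Spec A)) (h : V `<=` basic_open f)
    (P : Spec A) (VP : V P) (Pf : ~ spec_ideal P f) :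
  spec_val (frac_sect a h) VP = frac a Pf.
Proof. exact: fracE. Qed.

(** This is all that is needed of the identification of the stalk at P with A_P. If s is a / f near
    P and a is outside P, then f / a is an inverse on a neighbourhood inside D(a). *)
Lemma germ_val_unit (U : opens (Spec A)) (s : sect U) (P : Spec A) (UP : U P) :
  is_unit (germ UP s) <-> is_unit (spec_val s UP).
Proof.
split.
  move=> [y]; have [V [VP [t ->]]] := germW y.
  have l : opensI U V `<=` U by exact: opensIl.
  have r : opensI U V `<=` V by exact: opensIr.
  have WP : opensI U V P by [].
  rewrite -(germ_res UP WP l) -(germ_res VP WP r) -rmorphM.
  rewrite -[RHS](rmorph1 (germ WP)) => /spec_val_germ.
  rewrite spec_valM spec_val1 (spec_val_res l s WP UP) => e.
  by exists (spec_val (res r t) WP).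
have [V [a [f [VP VU sE]]]] := spec_valW s UP.
have [Pf ->] := sE P UP VP; move=> /frac_unit Pa.
pose W := opensI V (basic_open a).
have l : W `<=` basic_open a by exact: opensIr.
have WU : W `<=` U by apply: subset_trans VU; exact: opensIl.
have WP : W P by [].
exists (germ WP (frac_sect f l)).
rewrite -(germ_res UP WP WU) -rmorphM -[RHS](rmorph1 (germ WP)).
congr (germ WP _); apply: spec_val_inj => Q WQ.
have [VQ Qa] := WQ; have [Qf e] := sE Q (WU Q WQ) VQ.
rewrite spec_valM spec_val1 (spec_val_res WU s WQ (WU Q WQ)) e.
by rewrite (frac_sectE _ _ _ Qa) fracM; apply: fracE; ring.
Qed.

Definition const_sect (U : opens (Spec A)) (a : A) : @sect (Spec A) U :=
  spec_const U a.

Lemma const_sectE (U : opens (Spec A)) (a : A) (P : Spec A) (UP : U P) :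
  spec_val (const_sect U a) UP = frac a (@spec_one A P).
Proof. by []. Qed.

Lemma const_sect_res (U V : opens (Spec A)) (h : V `<=` U) (a : A) :
  res h (const_sect U a) = const_sect V a.
Proof. exact: spec_val_inj. Qed.

Lemma const_germ_unit (U : opens (Spec A)) (a : A) (P : Spec A) (UP : U P) :
  is_unit (germ UP (const_sect U a)) <-> ~ spec_ideal P a.
Proof. by rewrite germ_val_unit const_sectE frac_unit. Qed.

Fact const_sect_zmod U : zmod_morphism (const_sect U).
Proof.
by move=> a b; apply: spec_sect_eq => P UP /=; rewrite fracN fracD;
  apply: fracE; ring.
Qed.

Fact const_sect_monoid U : monoid_morphism (const_sect U).
Proof.
split=> [|a b]; apply: spec_sect_eq => P UP //=.
by rewrite fracM; apply: fracE; ring.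
Qed.

HB.instance Definition _ U :=
  GRing.isZmodMorphism.Build A (sect U) (const_sect U) (const_sect_zmod U).
HB.instance Definition _ U :=
  GRing.isMonoidMorphism.Build A (sect U) (const_sect U) (const_sect_monoid U).

(** Equality in every A_P means that the annihilator of a - b is contained in no prime, so it
    contains 1. *)
Lemma const_sect_inj (U : opens (Spec A)) (a b : A) : U = setT :> set _ ->
  const_sect U a = const_sect U b -> a = b.
Proof.
move=> UT e.
pose I := [set t : A | t * (a - b) = 0].
suff /= : I 1 by rewrite /I /= mul1r => /eqP; rewrite subr_eq0 => /eqP.
apply: unit_ideal.
  split=> //=; first by rewrite /I /= mul0r.
    by move=> x y; rewrite /I /= mulrDl => -> ->; rewrite addr0.
  by move=> r x _; rewrite /I /= -mulrA => ->; rewrite mulr0.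
move=> P; have UP : U (P : Spec A) by rewrite UT.
have : spec_val (const_sect U a) UP = spec_val (const_sect U b) UP by rewrite e.
by rewrite !const_sectE => /frac_eqP[u Pu]; rewrite !mulr1; exists u.
Qed.

End SpecSections.

(** * The morphism of spectra induced by a ring homomorphism *)

Section SpecMap.
Variables (A B : comPzRingType) (h : {rmorphism A -> B}).

Fact comap_prime (P : spec_pt B) : is_prime setT (h @^-1` P).
Proof.
have [[_ P0 PD PM] P1 Pp] := spec_prime P; split; first split=> //.
- by rewrite /= rmorph0.
- by move=> x y Px Py; rewrite /= rmorphD; exact: PD.
- by move=> r x _ Px; rewrite /= rmorphM; exact: PM.
- by rewrite /= rmorph1.
- by move=> x y _ _; rewrite /= rmorphM => /Pp; exact.
Qed.

Definition comap (P : Spec B) : Spec A := SpecPt (comap_prime P).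

Lemma comap_continuous : continuous comap.
Proof.
apply/continuousP => _ [E ->]; exists (h @` E).
apply/seteqP; split=> P /= EP; first by move=> hE; apply: EP => a Ea;
  apply: hE; exists a.
by move=> Eh; apply: EP => _ [a Ea <-]; exact: Eh.
Qed.

Definition loc_map (P : Spec B) (x : localization (comap P)) : localization P :=
  frac (h (pnum (repr x))) (@pdenP _ _ (repr x) : ~ spec_ideal P (h (pden (repr
    x)))).

Lemma loc_mapE (P : Spec B) (a s : A) (Ps : ~ spec_ideal (comap P) s)
    (Ps' : ~ spec_ideal P (h s)) :
  loc_map (frac a Ps) = frac (h a) Ps'.
Proof.
rewrite /loc_map; have [u Pu e] := frac_repr a Ps.
apply/frac_eqP; exists (h u) => //.
by rewrite -!rmorphM -rmorphB -rmorphM e rmorph0.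
Qed.

Lemma loc_mapB (P : Spec B) (x y : localization (comap P)) :
  loc_map (x - y) = loc_map x - loc_map y.
Proof.
have [a [s [Ps ->]]] := fracW x; have [b [t [Pt ->]]] := fracW y.
rewrite fracN fracD !(loc_mapE _ Ps (Ps : ~ spec_ideal P (h s))).
rewrite (loc_mapE _ Pt (Pt : ~ spec_ideal P (h t))) fracN fracD.
have := loc_mapE (a * t + - b * s) (spec_mul Ps Pt) (spec_mul Ps Pt : ~
  spec_ideal P (h (s * t))).
by move=> ->; apply: fracE; rewrite !(rmorphD, rmorphM, rmorphN).
Qed.

Lemma loc_mapM (P : Spec B) (x y : localization (comap P)) :
  loc_map (x * y) = loc_map x * loc_map y.
Proof.
have [a [s [Ps ->]]] := fracW x; have [b [t [Pt ->]]] := fracW y.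
rewrite fracM !(loc_mapE _ Ps (Ps : ~ spec_ideal P (h s))).
rewrite (loc_mapE _ Pt (Pt : ~ spec_ideal P (h t))) fracM.
have := loc_mapE (a * b) (spec_mul Ps Pt) (spec_mul Ps Pt : ~ spec_ideal P (h
  (s * t))).
by move=> ->; apply: fracE; rewrite !(rmorphD, rmorphM, rmorphN).
Qed.

Lemma loc_map1 (P : Spec B) : loc_map (1 : localization (comap P)) = 1.
Proof.
have P1 : ~ spec_ideal P (h 1) by rewrite rmorph1; exact: spec_one.
have -> : (1 : localization (comap P)) = frac 1 (@spec_one A (comap P)) by [].
by rewrite (loc_mapE _ _ P1); apply: fracE; rewrite rmorph1.
Qed.

Section Pull.
Variable V : opens (Spec A).

Fact spec_pull_frac (s : @sect (Spec A) V) :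
  @locally_frac B (opens_preim comap_continuous V)
    (fun P VP => loc_map (@spec_val A V s (comap P) VP)).
Proof.
move=> P VP; have [W [a [f [WP WV sE]]]] := spec_valW s (VP : V (comap P)).
exists (opens_preim comap_continuous W), (h a), (h f); split=> //.
  by move=> Q; exact: WV.
move=> Q VQ WQ; have [Qf ->] := sE (comap Q) VQ WQ.
by exists Qf; rewrite (loc_mapE _ _ (Qf : ~ spec_ideal Q (h f))).
Qed.

Definition spec_pull (s : @sect (Spec A) V) :
    @sect (Spec B) (opens_preim comap_continuous V) :=
  SpecSect (spec_pull_frac s).

Fact spec_pull_zmod : zmod_morphism spec_pull.
Proof. by move=> s t; apply: spec_sect_eq => P VP; exact: loc_mapB. Qed.

Fact spec_pull_monoid : monoid_morphism spec_pull.
Proof.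
split=> [|s t]; apply: spec_sect_eq => P VP; [exact: loc_map1|exact: loc_mapM].
Qed.

HB.instance Definition _ := GRing.isZmodMorphism.Build _ _ spec_pull
  spec_pull_zmod.
HB.instance Definition _ :=
  GRing.isMonoidMorphism.Build _ _ spec_pull spec_pull_monoid.

Lemma spec_pull_val (s : @sect (Spec A) V) (P : Spec B)
    (VP : opens_preim comap_continuous V P) (VP' : V (comap P)) :
  spec_val (spec_pull s) VP = loc_map (spec_val s VP').
Proof. by rewrite (Prop_irrelevance VP' VP). Qed.

End Pull.

Fact spec_pull_res (U V : opens (Spec A)) (k : V `<=` U)
  (l : opens_preim comap_continuous V `<=` opens_preim comap_continuous U)
  (s : @sect (Spec A) U) : spec_pull (res k s) = res l (spec_pull s).
Proof.
apply: spec_val_inj => P VP; have UP := l P VP.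
rewrite (spec_val_res l _ VP UP) (spec_pull_val _ VP VP) (spec_pull_val _ UP
  UP).
by rewrite (spec_val_res k _ VP UP).
Qed.

Fact spec_pull_local (P : Spec B) (V : opens (Spec A)) (VP : V (comap P))
    (s : @sect (Spec A) V) :
  is_unit (@germ (Spec B) P (opens_preim comap_continuous V) VP (spec_pull s))
    ->
  is_unit (germ VP s).
Proof.
move=> /germ_val_unit; rewrite (spec_pull_val s _ VP) => u.
apply/germ_val_unit; move: u; have [a [f [Pf ->]]] := fracW (spec_val s VP).
by rewrite (loc_mapE _ _ (Pf : ~ spec_ideal P (h f))) => /frac_unit Pa;
  apply/frac_unit.
Qed.

Definition spec_map : morphism (Spec B) (Spec A) :=
  @Morphism (Spec B) (Spec A) comap comap_continuous
    (fun V => (@spec_pull V : {rmorphism sect V -> sect _}))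
    spec_pull_res spec_pull_local.

End SpecMap.

Lemma spec_pt_eq (A : comPzRingType) (P Q : spec_pt A) :
  spec_ideal P = spec_ideal Q -> P = Q.
Proof.
case: P Q => [P pP] [Q pQ] /= e; move: pP; rewrite e => pP.
by congr SpecPt; exact: Prop_irrelevance.
Qed.

Lemma zero_prime (A : comPzRingType) (K : fieldType)
  (sigma : {rmorphism A -> K}) : injective sigma -> is_prime setT [set 0 : A].
Proof.
move=> si; split; first split=> //.
- by move=> _ _ -> ->; rewrite /= addr0.
- by move=> r _ _ ->; rewrite /= mulr0.
- by move=> /(congr1 sigma)/eqP; rewrite rmorph1 rmorph0 oner_eq0.
move=> x y _ _ /(congr1 sigma); rewrite rmorphM rmorph0 => /eqP.
by rewrite mulf_eq0 => /orP[]/eqP; rewrite -(rmorph0 sigma) => /si;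
  [left|right].
Qed.

Lemma injective_neq0 (A : comPzRingType) (K : fieldType)
  (sigma : {rmorphism A -> K}) (P : spec_pt A) s :
  injective sigma -> ~ P s -> sigma s != 0.
Proof.
move=> si Ps; apply/eqP; rewrite -(rmorph0 sigma) => /si s0; apply: Ps.
by rewrite s0; exact: ideal0.
Qed.

(** The local fraction s = a / f is written as the equation s f = a between sections, which any
    pullback preserves. *)
Lemma sect_local_frac (A : comPzRingType) (V : opens (Spec A)) (s : sect V)
    (P : Spec A) : V P ->
  exists (Z : opens (Spec A)) (ZV : Z `<=` V) (a f : A), [/\ Z P,
    ~ spec_ideal P f & res ZV s * const_sect Z f = const_sect Z a].
Proof.
move=> VP; have [V' [a [f [V'P V'V sE]]]] := spec_valW s VP.
have [Pf _] := sE P VP V'P.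
pose Z := opensI V' (basic_open f).
have ZV : Z `<=` V by apply: subset_trans V'V; exact: opensIl.
exists Z, ZV, a, f; split=> //.
apply: spec_val_inj => Q ZQ; have [VQ Qf] := ZQ.
have [Qf' sQ] := sE Q (ZV Q ZQ) VQ.
rewrite spec_valM (spec_val_res ZV s ZQ (ZV Q ZQ)) sQ !const_sectE fracM.
by apply: fracE; ring.
Qed.

Lemma spec_quasi_compact (A : comPzRingType) (G : set A) :
  (forall P : spec_pt A, exists2 g, G g & ~ P g) ->
  exists2 L : seq A, [set` L] `<=` G &
    forall P : spec_pt A, exists2 g, g \in L & ~ P g.
Proof.
move=> h.
(* d is in J if D(d) is covered by finitely many D(g), g in G. *)
pose J := [set d | exists2 L : seq A, [set` L] `<=` G &
  forall P : spec_pt A, ~ P d -> exists2 g, g \in L & ~ P g].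
suff [L LG LP] : J 1 by exists L => // P; apply: LP; exact: spec_one.
apply: unit_ideal => [|P]; last first.
  have [g Gg Pg] := h P; exists g => //; exists [:: g].
    by move=> x; rewrite /= inE => /eqP ->.
  by move=> Q Qg; exists g; rewrite ?mem_head.
split=> //.
- by exists [::] => // P; case; exact: ideal0.
- move=> x y [L LG Lx] [M MG My]; exists (L ++ M).
        by move=> g /=; rewrite mem_cat => /orP[/LG|/MG].
      move=> P Pxy; have [Px|Px] := pselect (P x); last first.
        by have [g gL Pg] := Lx P Px; exists g; rewrite ?mem_cat ?gL.
      have [g gM Pg] : exists2 g, g \in M & ~ P g.
        apply: My => Py; apply: Pxy.
        by have [[_ _ PD _] _ _] := spec_prime P; exact: PD.
      by exists g; rewrite ?mem_cat ?gM ?orbT.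
- move=> r x _ [L LG Lx]; exists L => // P Prx; apply: Lx => Px; apply: Prx.
      exact: idealMl.
Qed.

(** * Morphisms into an affine scheme *)

Section StructureMap.
Variables (T : ringedSpace) (D : comPzRingType).

Lemma structure_map_germ (g : morphism T (Spec D)) (V : opens (Spec D))
    (t : T) (Vt : V (g t)) (d : D) :
  @germ T t (opens_preim (@mcont _ _ g) V) Vt (pull g V (const_sect V d)) =
  structure_map g t d.
Proof.
have h : V `<=` opensT (Spec D) by [].
have k : opens_preim (@mcont _ _ g) V `<=` opens_preim (@mcont _ _ g) (opensT
  _).
  by [].
rewrite /structure_map -/(const_sect (opensT (Spec D)) d).
rewrite -(const_sect_res h) (pull_res h k).
exact: (@germ_res T t (opens_preim _ (opensT _)) (opens_preim _ V) I Vt k).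
Qed.

Lemma structure_map_unit (g : morphism T (Spec D)) (t : T) (d : D) :
  is_unit (structure_map g t d) <-> ~ spec_ideal (g t) d.
Proof.
by rewrite -(@structure_map_germ g (opensT _) t I) pull_germ_unit
  const_germ_unit.
Qed.

(** The point g t consists of the d whose germ at t is not a unit, so the constants determine the
    map on points. A section is locally a / f with f a unit at the image point, so they determine
    the pullbacks too. *)
Lemma spec_target_eq (g h : morphism T (Spec D)) :
  (forall t d, structure_map g t d = structure_map h t d) -> mor_eq g h.
Proof.
move=> e; have gh t : g t = h t.
  have N d : ~ spec_ideal (g t) d <-> ~ spec_ideal (h t) d.
    by rewrite -!structure_map_unit e.
  by apply: spec_pt_eq; apply/seteqP; split=> d gd; apply: contrapT => /N.
split=> // V W k l s; apply: germ_sep => t Wt.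
have gt := k t Wt; have ht := l t Wt.
rewrite (germ_res (gt : opens_preim _ V t)) (germ_res (ht : opens_preim _ V t)).
have [Z [ZV [a [f [Zt Qf q]]]]] := sect_local_frac s (gt : V (g t)).
have Zt' : Z (h t) by rewrite -gh.
have key (g' : morphism T (Spec D)) (Vt' : V (g' t)) (Zt'' : Z (g' t)) :
    @germ T t (opens_preim (@mcont _ _ g') V) Vt' (pull g' V s)
      * structure_map g' t f = structure_map g' t a.
  have m : opens_preim (@mcont _ _ g') Z `<=` opens_preim (@mcont _ _ g') V.
    by move=> y; exact: ZV.
  rewrite -(germ_res (Vt' : opens_preim _ V t) (Zt'' : opens_preim _ Z t) m).
  by rewrite -(pull_res ZV m) -!(structure_map_germ Zt'') -rmorphM -rmorphM q.
have u : is_unit (structure_map g t f) by apply/structure_map_unit.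
apply: (unit_cancel u); rewrite (key g gt Zt) e.
by rewrite e (key h ht Zt').
Qed.

End StructureMap.

(** * Integral schemes inside their function field *)

Section FunctionField.
Variables (X : ringedSpace) (eta : X) (K : fieldType).
Variable phi : {rmorphism stalk eta -> K}.
Hypotheses (X_scheme : is_scheme X) (X_integral : is_integral X).
Hypotheses (eta_generic : generic_point eta) (phi_bij : bijective phi).

Lemma generic_mem (U : opens X) x : U x -> U eta.
Proof.
move=> Ux; have : closure [set eta] x by rewrite eta_generic.
by move=> /(_ U (open_nbhs_nbhs (conj (openP U) Ux)))[y [-> ]].
Qed.

Lemma phi_inj : injective phi. Proof. exact: bij_inj. Qed.

Definition ev (U : opens X) (h : U eta) : {rmorphism sect U -> K} :=
  phi \o germ h.

Lemma ev_res (U V : opens X) (k : V `<=` U) (VE : V eta) (UE : U eta)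
  (s : sect U) : ev VE (res k s) = ev UE s.
Proof. by rewrite /ev /= germ_res. Qed.

(** The image of O_{X,x} in K: eta lies in every nonempty open set, so a section near x has a germ
    at eta. *)
Definition local_ring (x : X) : set K :=
  [set z | exists (U : opens X) (UE : U eta) (s : sect U), U x /\ ev UE s = z].

Lemma local_ring_ev (U : opens X) (UE : U eta) (s : sect U) x : U x ->
  local_ring x (ev UE s).
Proof. by move=> Ux; exists U, UE, s. Qed.

(** * An affine chart and its ring inside K *)

Section Chart.
Variables (A : comPzRingType) (j : morphism (Spec A) X).
Hypotheses (jo : open_immersion j) (j_eta : range j eta).

Fact chart_image_open (W : opens (Spec A)) : open (j @` W).
Proof. by case: jo => _ h _; apply: h; exact: openP. Qed.

Definition chart_image (W : opens (Spec A)) : opens X :=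
  Opens (chart_image_open W).

Lemma chart_inj : injective j. Proof. by case: jo. Qed.

Lemma chart_image_range (W : opens (Spec A)) : chart_image W `<=` range j.
Proof. by move=> _ [P _ <-]; exists P. Qed.

Lemma chart_imageE (W : opens (Spec A)) P : chart_image W (j P) <-> W P.
Proof. by split=> [[Q WQ /chart_inj <-]|WP]; [|exists P]. Qed.

Lemma pull_bij (V : opens X) : V `<=` range j -> bijective (pull j V).
Proof. by case: jo => _ _ h; exact: h. Qed.

Lemma pull_surj (V : opens X) (t : sect (opens_preim (@mcont _ _ j) V)) :
  V `<=` range j -> exists s, pull j V s = t.
Proof. by move=> /pull_bij[g _ Kg]; exists (g t). Qed.

Lemma pull_res_val (U V : opens X) (h : V `<=` U) (s : sect U) P
    (VP : V (j P)) (UP : U (j P)) :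
  @spec_val A (opens_preim (@mcont _ _ j) V) (pull j V (res h s)) P VP =
  @spec_val A (opens_preim (@mcont _ _ j) U) (pull j U s) P UP.
Proof.
have k : opens_preim (@mcont _ _ j) V `<=` opens_preim (@mcont _ _ j) U.
  by move=> Q; exact: h.
by rewrite (pull_res h k) (spec_val_res k _ (VP : opens_preim _ V P) UP).
Qed.

Definition chart_open := chart_image (opensT (Spec A)).

Lemma chart_open_eta : chart_open eta. Proof. exact: j_eta. Qed.

(** Only this direction, from A to the sections over the chart, is constructed. That nothing else
    occurs among their values is shown inside K, by [chart_range_ev]. *)
Definition chart_sect (a : A) : sect chart_open :=
  sval (cid (pull_surj (const_sect _ a) (@chart_image_range _))).

Lemma chart_sectE a : pull j chart_open (chart_sect a) = const_sect _ a.
Proof. exact: (svalP (cid (pull_surj _ _))). Qed.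

Lemma pull_chart_inj : injective (pull j chart_open).
Proof. exact/bij_inj/pull_bij/chart_image_range. Qed.

Fact chart_sect_zmod : zmod_morphism chart_sect.
Proof.
by move=> a b; apply: pull_chart_inj; rewrite rmorphB !chart_sectE rmorphB.
Qed.

Fact chart_sect_monoid : monoid_morphism chart_sect.
Proof.
split=> [|a b]; apply: pull_chart_inj; rewrite ?rmorph1 ?rmorphM !chart_sectE.
  exact: rmorph1.
exact: rmorphM.
Qed.

HB.instance Definition _ :=
  GRing.isZmodMorphism.Build _ _ chart_sect chart_sect_zmod.
HB.instance Definition _ :=
  GRing.isMonoidMorphism.Build _ _ chart_sect chart_sect_monoid.

Definition chart_embed : {rmorphism A -> K} := ev chart_open_eta \o chart_sect.

Local Notation alpha := chart_embed.

Lemma chart_embedE a : alpha a = ev chart_open_eta (chart_sect a).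
Proof. by []. Qed.

(** The equation s c = b holds on a whole neighbourhood of j P, and this contains eta. It is stated
    as a product because [alpha c != 0] follows only from [chart_embed_inj]. *)
Lemma chart_ev (V : opens X) (VE : V eta) (s : sect V) (P : Spec A)
    (VP : V (j P)) (b c : A) (Pc : ~ spec_ideal P c) :
  @spec_val A (opens_preim (@mcont _ _ j) V) (pull j V s) P VP = frac b Pc ->
  ev VE s * alpha c = alpha b.
Proof.
have [W [a [f [WP WV sE]]]] :=
  @spec_valW A (opens_preim (@mcont _ _ j) V) (pull j V s) P VP.
have [Pf ->] := sE P VP WP; move=> /frac_eqP[u Pu e].
(* On W the section is a / f; on D(u) the relation u (a c - b f) = 0 gives a / f = b / c. *)
pose W' := opensI W (opensI (basic_open c) (basic_open u)).
have Z_V : chart_image W' `<=` V by move=> _ [Q [WQ _] <-]; exact: WV WQ.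
have Z_j : chart_image W' `<=` chart_open by exact: chart_image_range.
have ZP : chart_image W' (j P) by exists P.
have ZE := generic_mem ZP.
suff t0 : res Z_V s * res Z_j (chart_sect c) = res Z_j (chart_sect b).
  rewrite !chart_embedE -(ev_res Z_V ZE VE) -!(ev_res Z_j ZE).
  by rewrite -rmorphM t0.
apply: (bij_inj (pull_bij (@chart_image_range W'))).
apply: spec_val_inj => Q ZQ.
have VQ : V (j Q) by exact: Z_V.
have jQ : chart_open (j Q) by exact: Z_j.
have [WQ [Qc Qu]] := (chart_imageE W' Q).1 ZQ.
rewrite rmorphM spec_valM (pull_res_val _ _ ZQ VQ) !(pull_res_val _ _ ZQ jQ).
have [Qf ->] := sE Q VQ WQ; rewrite !chart_sectE !const_sectE fracM.
apply/frac_eqP; exists u => //.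
by rewrite -[RHS]e; ring.
Qed.

(* Integrality of X enters here: if a vanishes at eta, then t a = 0 in A for
   some t outside the prime of eta. *)
Lemma chart_embed_inj : injective alpha.
Proof.
suff h a : alpha a = 0 -> a = 0.
  by move=> a b /eqP; rewrite -subr_eq0 -rmorphB => /eqP/h/eqP;
    rewrite subr_eq0 => /eqP.
rewrite chart_embedE /ev /= -(rmorph0 phi) => /phi_inj.
rewrite -(rmorph0 (germ chart_open_eta)) => /germ_eqP[W [h [k [WE e]]]].
have [P0 _ jP0] := j_eta.
have jo0 : chart_open (j P0) by exists P0.
have WP0 : W (j P0) by rewrite jP0.
have := pull_res_val h (chart_sect a) WP0 jo0.
rewrite e (pull_res_val k 0 WP0 jo0) chart_sectE rmorph0 const_sectE.
have -> : (0 : @sect (Spec A) (opens_preim (@mcont _ _ j) chart_open)) =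
  const_sect _ 0.
  by rewrite rmorph0.
rewrite const_sectE => /frac_eqP[t Pt]; rewrite !mulr1 sub0r mulrN.
move=> /eqP; rewrite oppr_eq0 => /eqP ta.
have preT : opens_preim (@mcont _ _ j) chart_open = setT :> set _.
  by rewrite -subTset => P _; exists P.
have z b : chart_sect b = 0 -> b = 0.
  move=> b0; apply: (const_sect_inj preT).
  by rewrite -chart_sectE b0 !rmorph0.
have [_ /(_ chart_open)[|_ /(_ (chart_sect t) (chart_sect a))]] := X_integral.
  by exists eta; exact: chart_open_eta.
rewrite -rmorphM ta rmorph0 => /(_ erefl)[/z t0|/z//].
by case: Pt; rewrite t0; exact: ideal0.
Qed.

Lemma chart_embed_neq0 a : a != 0 -> alpha a != 0.
Proof.
by apply: contra => /eqP; rewrite -(rmorph0 alpha) => /chart_embed_inj ->.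
Qed.

Lemma chart_embed_notin (P : Spec A) f : ~ spec_ideal P f -> alpha f != 0.
Proof.
move=> Pf; apply: chart_embed_neq0; apply/eqP => f0; apply: Pf; rewrite f0.
exact: ideal0.
Qed.

Lemma chart_subring : is_subring (range alpha).
Proof.
split; first by exists 1 => //; rewrite rmorph1.
  by move=> _ _ [a _ <-] [b _ <-]; exists (a - b) => //; rewrite rmorphB.
by move=> _ _ [a _ <-] [b _ <-]; exists (a * b) => //; rewrite rmorphM.
Qed.

Lemma chart_prime (P : Spec A) : is_prime (range alpha) (alpha @` P).
Proof.
have [[_ P0 PD PM] P1 Pp] := spec_prime P; split; first split.
- by move=> _ [a _ <-]; exists a.
- by exists 0 => //; rewrite rmorph0.
- by move=> _ _ [a Pa <-] [b Pb <-]; exists (a + b);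
  [exact: PD|rewrite rmorphD].
- by move=> _ _ [a _ <-] [b Pb <-]; exists (a * b); [exact: PM|rewrite rmorphM].
- by move=> [a Pa]; rewrite -(rmorph1 alpha) => /chart_embed_inj a1;
  rewrite a1 in Pa.
- move=> _ _ [a _ <-] [b _ <-] [c Pc]; rewrite -rmorphM => /chart_embed_inj cE.
  by rewrite cE in Pc; have [Pa|Pb] := Pp _ _ I I Pc; [left; exists a|right;
    exists b].
Qed.

Lemma chart_prime_surj (Q : set K) : is_prime (range alpha) Q ->
  exists P : Spec A, alpha @` P = Q.
Proof.
move=> [[QR Q0 QD QM] Q1 Qp].
have pP : is_prime setT (alpha @^-1` Q).
  split; first split=> //.
  - by rewrite /= !rmorph0.
  - by move=> x y Qx Qy; rewrite /= !rmorphD; exact: QD.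
  - by move=> r x _ Qx; rewrite /= !rmorphM; apply: QM => //; exists r.
  - by rewrite /= !rmorph1.
  - by move=> x y _ _; rewrite /= !rmorphM => Qxy; apply: Qp Qxy;
    [exists x|exists y].
exists (SpecPt pP); apply/seteqP; split=> x /=; first by move=> [a Qa <-].
by move=> Qx; have [a _ aE] := QR _ Qx; exists a => //; change (Q (alpha a));
  rewrite aE.
Qed.

Lemma chart_local_ring (P : Spec A) :
  local_ring (j P) = localize (range alpha) (alpha @` P).
Proof.
apply/seteqP; split=> z.
  move=> [U [UE [s [UP <-]]]].
  have [a [f [Pf e]]] :=
    fracW (@spec_val A (opens_preim (@mcont _ _ j) U) (pull j U s) P UP).
  exists (alpha a), (alpha f); split; [by exists a|by exists f| |].
    by move=> [b Pb /chart_embed_inj bf]; rewrite bf in Pb.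
  by rewrite -(chart_ev UE e) mulfK //; exact: chart_embed_notin Pf.
move=> [_ [_ [[a _ <-] [f _ <-] Pf' ->]]].
have Pf : ~ spec_ideal P f by move=> Pf; apply: Pf'; exists f.
(* The fraction a / f is a section over D(f); as [pull j] is bijective there, it comes from a
   section over the image of D(f). *)
pose W := chart_image (basic_open f).
have WP : W (j P) by apply/chart_imageE.
have pW : opens_preim (@mcont _ _ j) W `<=` basic_open f by move=> Q
  /chart_imageE.
have [s sE] := pull_surj (frac_sect a pW) (@chart_image_range _).
exists W, (generic_mem WP), s; split=> //.
have := @chart_ev W (generic_mem WP) s P WP a f Pf.
rewrite sE (frac_sectE a pW (WP : opens_preim _ W P) Pf) => /(_ erefl) <-.
by rewrite mulfK //; exact: chart_embed_notin Pf.
Qed.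

(** The ideal I of denominators of the value of s contains an element outside each prime, namely the
    denominator of s at that point. *)
Lemma chart_ev_range (U : opens X) (UE : U eta) (s : sect U) :
  U = range j :> set X -> exists a, ev UE s = alpha a.
Proof.
move=> Uj; pose I := [set f | range alpha (ev UE s * alpha f)].
suff [a _ aE] : I 1 by exists a; rewrite aE rmorph1 mulr1.
apply: unit_ideal => [|P].
  split=> //.
  - by exists 0 => //; rewrite !rmorph0 mulr0.
  - by move=> x y [a _ ax] [b _ bx]; exists (a + b) => //;
    rewrite !rmorphD mulrDr ax bx.
  - by move=> r x _ [a _ ax]; exists (r * a) => //; rewrite !rmorphM ax; ring.
have UP : U (j P) by rewrite Uj; exists P.
have [a [f [Pf e]]] :=
  fracW (@spec_val A (opens_preim (@mcont _ _ j) U) (pull j U s) P UP).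
by exists f => //; exists a => //; rewrite (chart_ev UE e).
Qed.

Lemma chart_range_ev (U : opens X) (UE : U eta) :
  U = range j :> set X -> range (ev UE) = range alpha.
Proof.
move=> Uj; apply/seteqP; split=> _ [s _ <-].
  by have [a ->] := chart_ev_range UE s Uj; exists a.
have h : U `<=` chart_open by rewrite Uj.
by exists (res h (chart_sect s)) => //; rewrite (ev_res h UE chart_open_eta).
Qed.

(** For f nonzero, the image of D(f) contains the point of the zero ideal; being nonempty and open
    it contains eta, so f is outside P. *)
Lemma chart_generic (P : Spec A) : j P = eta -> spec_ideal P = [set 0].
Proof.
move=> jP; apply/seteqP; split=> [f Pf|_ ->]; last exact: ideal0.
apply: contrapT => /eqP/chart_embed_neq0 f0.
pose I := [set 0 : K].
have pI : is_prime (range alpha) I.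
  split; first split.
  - by move=> _ ->; exists 0 => //; rewrite rmorph0.
  - by [].
  - by move=> _ _ -> ->; rewrite /I /= addr0.
  - by move=> r _ _ ->; rewrite /I /= mulr0.
  - by move=> /eqP; rewrite oner_eq0.
  - by move=> x y _ _ /eqP; rewrite mulf_eq0 => /orP[]/eqP; [left|right].
have [Q QI] := chart_prime_surj pI.
have WQ : chart_image (basic_open f) (j Q).
  apply/chart_imageE => Qf.
  have fI : (alpha @` Q) (alpha f) by exists f.
  by move: fI f0; rewrite QI => ->; rewrite eqxx.
by have := generic_mem WQ; rewrite -jP => /chart_imageE.
Qed.

End Chart.

Arguments chart_embed_inj {A j} jo j_eta [x1 x2].
Arguments chart_ev {A j} jo j_eta {V} VE {s P VP b c Pc}.
Arguments chart_local_ring {A j} jo j_eta P.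

Lemma chart_at x : exists (A : comPzRingType) (j : morphism (Spec A) X) (P :
  Spec A),
  [/\ open_immersion j, range j eta & j P = x].
Proof.
have [U Ux [A [j [jo jU]]]] := X_scheme x.
have [P _ jP] : range j x by rewrite jU.
by exists A, j, P; split=> //; rewrite jU; exact: generic_mem Ux.
Qed.

(** * Sections and local rings in terms of values in K *)

Lemma sect_uniq (U : opens X) (s t : sect U) :
  (forall UE : U eta, ev UE s = ev UE t) -> s = t.
Proof.
move=> e; have [UE|UE] := pselect (U eta); last first.
  (* Without eta, U is empty, and the empty family covers it. *)
  apply: (@sheaf_inj X False U (False_rect _)) => // x /generic_mem //.
pose I := {V : opens X | V `<=` U /\
  exists (A : comPzRingType) (j : morphism (Spec A) X),
    [/\ open_immersion j, range j eta & V `<=` range j]}.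
apply: (@sheaf_inj X I U (fun V => sval V) (fun V => (svalP V).1)).
  move=> x Ux; have [A [j [P [jo jE jP]]]] := chart_at x.
  pose V := opensI U (chart_open jo).
  have h : V `<=` U /\ exists (A : comPzRingType) (j : morphism (Spec A) X),
    [/\ open_immersion j, range j eta & V `<=` range j].
    by split; [exact: opensIl|exists A, j; split=> //; exact: opensIr].
  by exists (exist _ V h) => //; split=> //; exists P.
move=> [V [h [A [j [jo jE Vj]]]]] /=.
rewrite (Prop_irrelevance (proj1 _) h).
apply: (bij_inj (pull_bij jo Vj)); apply: spec_val_inj => P VP.
have VE := generic_mem (VP : V (j P)).
have [a [f [Pf es]]] := fracW (@spec_val A (opens_preim (@mcont _ _ j) V) (pull
  j V (res h s)) P VP).
have [b [g [Pg et]]] := fracW (@spec_val A (opens_preim (@mcont _ _ j) V) (pull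
  j V (res h t)) P VP).
rewrite es et; apply: fracE; apply: (chart_embed_inj jo jE).
rewrite !rmorphM -(chart_ev jo jE VE es) -(chart_ev jo jE VE et).
rewrite !(ev_res h VE UE) (e UE); ring.
Qed.

(** The open subsets of U that carry a section with value z cover U, and these sections agree on
    overlaps by [sect_uniq]. *)
Lemma sect_glue (U : opens X) (z : K) : (forall x, U x -> local_ring x z) ->
  exists s : sect U, forall UE : U eta, ev UE s = z.
Proof.
move=> Rz.
pose I := {V : opens X | V `<=` U /\
  exists s : sect V, forall VE : V eta, ev VE s = z}.
pose F (i : I) := sval i.
pose sF (i : I) : sect (F i) := sval (cid (svalP i).2).
have sFE i (VE : F i eta) : ev VE (sF i) = z.
  exact: (svalP (cid (svalP i).2)).
have cov : U `<=` \bigcup_i F i.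
  move=> x Ux; have [V [VE [s [Vx sz]]]] := Rz x Ux.
  have h : opensI U V `<=` U /\ exists s : sect (opensI U V),
      forall VE : opensI U V eta, ev VE s = z.
    split; first exact: opensIl.
    have r : opensI U V `<=` V by exact: opensIr.
    by exists (res r s) => WE; rewrite (ev_res r WE VE).
  by exists (exist _ (opensI U V) h).
have compat i k : res (@opensIl _ (F i) (F k)) (sF i) =
    res (@opensIr _ (F i) (F k)) (sF k).
  apply: sect_uniq => WE; have [iE kE] := WE.
  by rewrite (ev_res _ WE iE) (ev_res _ WE kE) !sFE.
have [t tE] := @sheaf_glue X I U F (fun i => (svalP i).1) cov sF compat.
exists t => UE; have [i _ iE] := cov _ UE.
by rewrite -(ev_res (svalP i).1 iE UE) tE sFE.
Qed.

Lemma germ_unit_ev (U : opens X) (UE : U eta) (s : sect U) x (Ux : U x) :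
  is_unit (germ Ux s) <-> ev UE s != 0 /\ local_ring x (ev UE s)^-1.
Proof.
split=> [/germ_unitP[W [h [t [Wx e]]]]|[s0 [V [VE [t [Vx tE]]]]]].
  have WE := generic_mem Wx.
  have e1 : ev UE s * ev WE t = 1.
    by rewrite -(ev_res h WE UE) -rmorphM e rmorph1.
  have s0 : ev UE s != 0.
    by apply/eqP => s0; move/eqP: e1; rewrite s0 mul0r eq_sym oner_eq0.
  split=> //; exists W, WE, t; split=> //.
  by apply: (mulfI s0); rewrite e1 mulfV.
have l : opensI U V `<=` U by exact: opensIl.
have r : opensI U V `<=` V by exact: opensIr.
apply/germ_unitP; exists (opensI U V), l, (res r t); split=> //.
apply: sect_uniq => WE;
  rewrite rmorphM rmorph1 (ev_res l WE UE) (ev_res r WE VE).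
by rewrite tE mulfV.
Qed.

Lemma local_ring_localize x : exists (A : comPzRingType)
    (alpha : {rmorphism A -> K}) (P : spec_pt A),
  [/\ is_subring (range alpha), is_prime (range alpha) (alpha @` P)
    & local_ring x = localize (range alpha) (alpha @` P)].
Proof.
have [A [j [P [jo jE <-]]]] := chart_at x.
exists A, (chart_embed jo jE), P; split;
  [exact: chart_subring|exact: chart_prime|].
exact: chart_local_ring.
Qed.

Lemma local_ring_subring x : is_subring (local_ring x).
Proof.
by have [A [alpha [P [sA pP ->]]]] := local_ring_localize x;
  exact: localize_subring.
Qed.

Lemma local_ring_nonunits x :
  is_ideal (local_ring x) (nonunits (local_ring x)).
Proof.
have [A [alpha [P [sA pP ->]]]] := local_ring_localize x.
exact: localize_nonunits_ideal.
Qed.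

(** An element of K is the germ at eta of a section. Read at the point over eta of a chart through
    x, it is a fraction of elements of the chart ring, which lies in R_x. *)
Lemma local_ring_frac x : has_frac_field (local_ring x).
Proof.
move=> z; have [g Kg gK] := phi_bij; have [U [UE [s gz]]] := germW (g z).
have -> : z = ev UE s by rewrite -[LHS]gK gz.
have [A [j [P [jo jE <-]]]] := chart_at x; have [P0 _ jP0] := jE.
have UP0 : U (j P0) by rewrite jP0.
have [a [f [Pf e]]] :=
  fracW (@spec_val A (opens_preim (@mcont _ _ j) U) (pull j U s) P0 UP0).
have R_range c : local_ring (j P) (chart_embed jo jE c).
  rewrite chart_local_ring; apply: sub_localize; first exact: chart_subring.
    exact: chart_prime.
  by exists c.
have f0 : chart_embed jo jE f != 0 by exact: chart_embed_notin Pf.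
exists (chart_embed jo jE a), (chart_embed jo jE f); split=> //.
by rewrite -(chart_ev jo jE UE e) mulfK.
Qed.

(* a is a morphism under Spec K: pulling a section back along a does not change
   its value in K. *)
Definition ev_compatible (S : comPzRingType) (sigma : {rmorphism S -> K})
    (a : morphism (Spec S) X) :=
  forall (V : opens X) (VE : V eta) (s : sect V) (P : Spec S) (VP : V (a P))
    (b c : S) (Pc : ~ spec_ideal P c),
  @spec_val S (opens_preim (@mcont _ _ a) V) (pull a V s) P VP = frac b Pc ->
  ev VE s * sigma c = sigma b.

Lemma ev_compatible_comp (S S' : comPzRingType) (sigma : {rmorphism S -> K})
    (sigma' : {rmorphism S' -> K}) (h : {rmorphism S -> S'})
    (a : morphism (Spec S) X) :
  injective sigma -> injective sigma' -> (forall x, sigma' (h x) = sigma x) ->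
  ev_compatible sigma a -> ev_compatible sigma' (mor_comp a (spec_map h)).
Proof.
move=> si si' hs ca V VE s P VP b c Pc.
pose VP' : V (a (comap h P)) := VP.
have -> : @spec_val S' (opens_preim (@mcont _ _ (mor_comp a (spec_map h))) V)
    (pull (mor_comp a (spec_map h)) V s) P VP =
  loc_map (@spec_val S (opens_preim (@mcont _ _ a) V) (pull a V s) (comap h P)
    VP').
  by [].
have [b' [c' [Pc' e]]] :=
  fracW (@spec_val S (opens_preim (@mcont _ _ a) V) (pull a V s) (comap h P)
    VP').
rewrite e (loc_mapE _ _ (Pc' : ~ spec_ideal P (h c'))) => /frac_eqP[u Pu].
move=> /(congr1 sigma'); rewrite rmorphM rmorphB !rmorphM rmorph0 !hs.
move=> /eqP; rewrite mulf_eq0 (negPf (injective_neq0 si' Pu)) subr_eq0 /=.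
rewrite -(ca V VE s _ VP' _ _ _ e) => /eqP q.
have c0 : sigma c' != 0 := injective_neq0 si Pc'.
by apply: (mulIf c0); rewrite -q; ring.
Qed.

Lemma ev_compatible_val (S : comPzRingType) (sigma : {rmorphism S -> K})
    (a b : morphism (Spec S) X) (V W : opens X) (VE : V eta) (WE : W eta)
    (s : sect V) (t : sect W) (P : Spec S) (VP : V (a P)) (WP : W (b P)) :
  injective sigma -> ev_compatible sigma a -> ev_compatible sigma b ->
  ev VE s = ev WE t ->
  @spec_val S (opens_preim (@mcont _ _ a) V) (pull a V s) P VP =
  @spec_val S (opens_preim (@mcont _ _ b) W) (pull b W t) P WP.
Proof.
move=> si ca cb e.
have [x [u [Pu es]]] := fracW (@spec_val S (opens_preim (@mcont _ _ a) V) (pull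
  a V s) P VP).
have [y [v [Pv et]]] := fracW (@spec_val S (opens_preim (@mcont _ _ b) W) (pull
  b W t) P WP).
rewrite es et; apply: fracE; apply: si.
rewrite !rmorphM -(ca V VE s P VP x u Pu es) -(cb W WE t P WP y v Pv et) e.
by ring.
Qed.

(** As S embeds in K, the values in K determine the pullbacks; only the maps on points remain to be
    compared. *)
Lemma ev_compatible_eq (S : comPzRingType) (sigma : {rmorphism S -> K})
    (a b : morphism (Spec S) X) :
  injective sigma -> ev_compatible sigma a -> ev_compatible sigma b ->
  a =1 b -> mor_eq a b.
Proof.
move=> si ca cb ab; split=> // V W k l s; apply: spec_val_inj => P WP.
have VE := generic_mem (k P WP : V (a P)).
rewrite (spec_val_res k _ WP (k P WP)) (spec_val_res l _ WP (l P WP)).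
exact: (ev_compatible_val _ _ si ca cb (erefl (ev VE s))).
Qed.

(** A nonzero f in the prime Q of the image point would pull back to a section with nonzero value,
    hence to a unit at P. By [pull_local] f would be a unit at that point, although it lies in Q. *)
Lemma ev_compatible_generic (sigma : {rmorphism K -> K})
    (a : morphism (Spec K) X) (P : Spec K) :
  injective sigma -> ev_compatible sigma a -> a P = eta.
Proof.
move=> si ca; have [A [j [Q [jo jE jQ]]]] := chart_at (a P).
have [P0 _ jP0] := jE; rewrite -jQ -jP0; congr (j _).
apply: spec_pt_eq; rewrite (chart_generic jo jE jP0).
apply/seteqP; split=> [f Qf|_ ->]; last exact: ideal0.
apply: contrapT => f0.
have f0' : chart_embed jo jE f != 0.
  by apply: chart_embed_neq0; apply/eqP.
have Va : chart_open jo (a P) by exists Q.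
pose VE := chart_open_eta jo jE.
pose s := chart_sect jo f.
have su : is_unit (germ Va s).
  apply/(@pull_local _ _ a)/germ_val_unit.
  have [b [c [Pc e]]] := fracW (@spec_val K (opens_preim (@mcont _ _ a)
    (chart_open jo)) (pull a _ s) P Va).
  rewrite [X in is_unit X]e; apply/frac_unit => Pb.
  have := ca _ VE s P Va b c Pc e.
  have -> : b = 0.
    apply/eqP; apply: contraT => b0; case: (spec_prime P) => -[_ _ _ PM] P1 _.
    by case: P1; rewrite -(mulVf b0); exact: PM.
  move=> /eqP; rewrite rmorph0 mulf_eq0 (negPf (injective_neq0 si Pc)) orbF.
  by rewrite (_ : ev VE s = chart_embed jo jE f) ?(negPf f0').
move: su => /(germ_unit_ev VE)[_].
rewrite -jQ (_ : ev VE s = chart_embed jo jE f) // chart_local_ring => Rf.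
have : nonunits (localize (range (chart_embed jo jE)) (chart_embed jo jE @` Q))
    (chart_embed jo jE f).
  have : (chart_embed jo jE @` Q) (chart_embed jo jE f) by exists f.
  rewrite -{1}(nonunits_localizeI (chart_subring jo jE) (chart_prime jo jE Q)).
  by case.
by move=> [_ /(_ Rf)/eqP]; rewrite (negPf f0').
Qed.

(** The ring A of a chart at x lies in R_x, hence in S, and the morphism is Spec S -> Spec A -> X.
    It sends Q to x because Q and the nonunits of R_x cut out the same prime of A. *)
Lemma spec_to_scheme (S : comPzRingType) (sigma : {rmorphism S -> K})
    (Q : Spec S) (x : X) :
  injective sigma -> local_ring x `<=` range sigma ->
  nonunits (local_ring x) = (sigma @` Q) `&` local_ring x ->
  exists a : morphism (Spec S) X, ev_compatible sigma a /\ a Q = x.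
Proof.
move=> si Rs Nx; have [A [j [P [jo jE jP]]]] := chart_at x.
pose al := chart_embed jo jE.
have al_inj : injective al by exact: chart_embed_inj.
have Rx : local_ring x = localize (range al) (al @` P).
  by rewrite -jP; exact: chart_local_ring.
have alR a : local_ring x (al a).
  rewrite Rx; apply: sub_localize; [exact: chart_subring|exact: chart_prime|].
  by exists a.
have hP a : exists b, sigma b = al a by have [b _ ba] := Rs _ (alR a); exists b.
pose h a := sval (cid (hP a)).
have hE a : sigma (h a) = al a by exact: (svalP (cid (hP a))).
have hz : zmod_morphism h.
  by move=> a b; apply: si; rewrite rmorphB !hE rmorphB.
have hm : monoid_morphism h.
  split=> [|a b]; apply: si; first by rewrite hE !rmorph1.
  by rewrite rmorphM !hE rmorphM.
pose ha := GRing.isZmodMorphism.Build _ _ h hz.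
pose hb := GRing.isMonoidMorphism.Build _ _ h hm.
pose hr : {rmorphism A -> S} := HB.pack h ha hb.
exists (mor_comp j (spec_map hr)); split.
  by apply: (@ev_compatible_comp _ _ al sigma hr j al_inj si hE) => V VE s P'
    VP b c Pc; exact: chart_ev.
rewrite -jP; congr (j _); apply: spec_pt_eq; apply/seteqP; split=> a /= aQ.
  have : nonunits (local_ring x) (al a).
    by rewrite Nx; split=> //; rewrite -hE; exists (h a).
  move=> na; have : (al @` P) (al a).
    rewrite -(nonunits_localizeI (chart_subring jo jE) (chart_prime jo jE P)).
    by split; [rewrite -Rx|exists a].
  by move=> [a' Pa' /al_inj <-].
have : nonunits (local_ring x) (al a).
  have : (al @` P) (al a) by exists a.
  rewrite -{1}(nonunits_localizeI (chart_subring jo jE) (chart_prime jo jE P)).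
  by rewrite -Rx => -[].
by rewrite Nx -hE => -[[b Qb /si <-]].
Qed.

(** * The structure morphism and separatedness *)

Section Structure.
Variables (D : idomainType) (iota : {rmorphism D -> K}) (f : morphism X (Spec
  D)).
Hypotheses (f_separated : separated f) (f_finite_type : finite_type f)
  (iota_inj : injective iota).
Hypothesis phi_structure : forall d : D, phi (structure_map f eta d) = iota d.

Lemma ev_structure (V : opens (Spec D))
    (VE : opens_preim (@mcont _ _ f) V eta) (d : D) :
  @ev (opens_preim (@mcont _ _ f) V) VE (pull f V (const_sect V d)) = iota d.
Proof. by rewrite -phi_structure -(structure_map_germ (VE : V (f eta))). Qed.

(** By [spec_target_eq] only constants matter. A constant d gives one section on X, with one value
    in K, so a and b pull it back to the same section. This is the hypothesis of the universal
    property. *)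
Lemma ev_compatible_structure (S : comPzRingType) (sigma : {rmorphism S -> K})
    (a b : morphism (Spec S) X) :
  injective sigma -> ev_compatible sigma a -> ev_compatible sigma b ->
  mor_eq (mor_comp f a) (mor_comp f b).
Proof.
move=> si ca cb; apply: spec_target_eq => P d.
pose F := opens_preim (@mcont _ _ f) (opensT (Spec D)).
have ka : opensT (Spec S) `<=`
  opens_preim (@mcont _ _ (mor_comp f a)) (opensT (Spec D)) by [].
have kb : opensT (Spec S) `<=`
  opens_preim (@mcont _ _ (mor_comp f b)) (opensT (Spec D)) by [].
apply: (germ_eqP _ _ _ _).1; exists (opensT (Spec S)), ka, kb.
split=> //; apply: spec_val_inj => Q UQ.
exact: (@ev_compatible_val S sigma a b F F I I
  (pull f _ (const_sect (opensT (Spec D)) d))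
  (pull f _ (const_sect (opensT (Spec D)) d)) Q (ka Q UQ) (kb Q UQ) si ca cb
    erefl).
Qed.

(** The map u = (a, b) sends the generic point of Spec S into the diagonal. The diagonal is closed,
    so u sends every point of Spec S there, and the two projections of u Q agree. *)
Lemma separated_point_eq (S : comPzRingType) (sigma : {rmorphism S -> K})
    (a b : morphism (Spec S) X) :
  injective sigma -> ev_compatible sigma a -> ev_compatible sigma b -> a =1 b.
Proof.
move=> si ca cb Q.
have [P [p [q [diag [[_ fpq univ] pd qd [_ diag_closed _]]]]]] := f_separated.
have [u [pu qu _]] := univ _ a b (@scheme_Spec S) (ev_compatible_structure si
  ca cb).
pose i := spec_map sigma.
have ii : injective (idfun : {rmorphism K -> K}) by [].
have cai : ev_compatible (idfun : {rmorphism K -> K}) (mor_comp a i).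
  exact: ev_compatible_comp si ii _ ca.
have cbi : ev_compatible (idfun : {rmorphism K -> K}) (mor_comp b i).
  exact: ev_compatible_comp si ii _ cb.
have ab_i : mor_eq (mor_comp a i) (mor_comp b i).
  apply: (ev_compatible_eq ii cai cbi) => R.
  by rewrite (ev_compatible_generic R ii cai) (ev_compatible_generic R ii cbi).
have [w [_ _ wu]] := univ _ _ _ (@scheme_Spec K)
  (ev_compatible_structure ii cai cbi).
(* On Spec K, both u and the diagonal after a solve the universal problem for the pair (a, b), hence
   they coincide. *)
have w1 : mor_eq (mor_comp u i) w.
  apply: wu.
    apply: mor_eq_trans (mor_comp_assoc p u i) _; exact: mor_comp_eql.
  by apply: mor_eq_trans (mor_comp_assoc q u i) _; exact: mor_comp_eql.
have diagE r : mor_eq (mor_comp r diag) (mor_id X) ->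
    mor_eq (mor_comp r (mor_comp diag (mor_comp a i))) (mor_comp a i).
  move=> rd; apply: mor_eq_trans (mor_comp_assoc r diag _) _.
  by apply: mor_eq_trans (mor_comp_eql _ rd) _; exact: mor_comp_idl.
have w2 : mor_eq (mor_comp diag (mor_comp a i)) w.
  by apply: wu; [exact: diagE|apply: mor_eq_trans (diagE q qd) ab_i].
have [z _ dz] : range diag (u Q).
  apply: contrapT => nQ.
  have cl : closed (range diag) by exact: diag_closed closedT.
  pose U : opens (Spec S) := opens_preim (@mcont _ _ u) (Opens (closed_openC
    cl)).
  have UQ : U Q by [].
  have [g Qg gU] := basic_open_base UQ.
  (* The image of this point in Spec S is the zero ideal, which lies in every D(g) with g nonzero,
     in particular in the preimage of the complement of the diagonal. *)
  pose o : Spec K := SpecPt (zero_prime ii).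
  have /gU : basic_open g (comap sigma o).
    by move=> /eqP; rewrite (negPf (injective_neq0 si Qg)).
  apply; exists (mor_comp a i o) => //.
  have [/(_ o) e1 _] := w1; have [/(_ o) e2 _] := w2.
  exact: etrans e2 (esym e1).
have [/(_ Q) paQ _] := pu; have [/(_ Q) qbQ _] := qu.
have [/(_ z) pz _] := pd; have [/(_ z) qz _] := qd.
by rewrite -paQ -qbQ /= -dz; apply: etrans pz (esym qz).
Qed.

Lemma dominated_point_eq (S Q : set K) (x y : X) : is_subring S ->
  is_prime S Q -> local_ring x `<=` S -> local_ring y `<=` S ->
  nonunits (local_ring x) = Q `&` local_ring x ->
  nonunits (local_ring y) = Q `&` local_ring y -> x = y.
Proof.
move=> sS pQ xS yS Nx Ny; have [A [sigma [si sE]]] := subring_ring sS.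
have [[QS Q0 QD QM] Q1 Qp] := pQ.
have sR a : S (sigma a) by rewrite -sE; exists a.
have pP : is_prime setT (sigma @^-1` Q).
  split; first split=> //.
  - by rewrite /= rmorph0.
  - by move=> a b Qa Qb; rewrite /= rmorphD; exact: QD.
  - by move=> r a _ Qa; rewrite /= rmorphM; exact: QM.
  - by rewrite /= rmorph1.
  - by move=> a b _ _; rewrite /= rmorphM => Qab; apply: Qp Qab.
pose P : Spec A := SpecPt pP.
have sP : sigma @` P = Q.
  apply/seteqP; split=> [_ [a Qa <-]//|z Qz].
  have : range sigma z by rewrite sE; exact: QS.
  by move=> [a _ az]; exists a => //; change (Q (sigma a)); rewrite az.
rewrite -sE in xS yS; rewrite -sP in Nx Ny.
have [a [ca <-]] := spec_to_scheme si xS Nx.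
have [b [cb <-]] := spec_to_scheme si yS Ny.
exact: (separated_point_eq si ca cb P).
Qed.

(** * Finitely many charts whose rings are affine over D *)

Lemma local_ring_open (z : K) : open [set x : X | local_ring x z].
Proof.
rewrite openE => x [U [UE [s [Ux sz]]]]; rewrite /interior /=.
apply: filterS (open_nbhs_nbhs (conj (openP U) Ux)) => y Uy.
by exists U, UE, s.
Qed.

Lemma iota_local_ring x d : local_ring x (iota d).
Proof.
pose F := opens_preim (@mcont _ _ f) (opensT (Spec D)).
rewrite -(@ev_structure (opensT _) I d).
exact: (@local_ring_ev F).
Qed.

Lemma local_ring_iotaV x (g : D) : ~ spec_ideal (f x) g ->
  local_ring x (iota g)^-1.
Proof.
pose F := opens_preim (@mcont _ _ f) (opensT (Spec D)).
move=> /structure_map_unit.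
rewrite -(@structure_map_germ _ _ f (opensT _) x I) => u.
rewrite -(@ev_structure (opensT _) I g).
by have [_] := (@germ_unit_ev F I _ x I).1 u.
Qed.

(* The last clause says that the sets {y in W | z in R_y} form a base of W. *)
Definition model_chart (W : opens X) (E : set K) :=
  [/\ forall x, W x -> exists2 P, is_prime E P & local_ring x = localize E P,
      forall P, is_prime E P -> exists2 x, W x & local_ring x = localize E P
    & forall (U : opens X) x, W x -> U x ->
      exists2 z, local_ring x z & forall y, W y -> local_ring y z -> U y].

Lemma model_chart_affine (A : comPzRingType) (j : morphism (Spec A) X)
    (jo : open_immersion j) (jE : range j eta) :
  model_chart (chart_open jo) (range (chart_embed jo jE)).
Proof.
pose al := chart_embed jo jE; split.
- move=> _ [P _ <-]; exists (al @` P); first exact: chart_prime.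
  exact: chart_local_ring.
- move=> P' /chart_prime_surj[P <-]; exists (j P); first by exists P.
  exact: chart_local_ring.
move=> U _ [P _ <-] UP.
have [g Pg gU] := @basic_open_base _ (opens_preim (@mcont _ _ j) U) P UP.
(* For D(g) inside the preimage of U: the inverse of g belongs to the local ring of a chart point
   exactly when g is outside its prime. *)
exists (al g)^-1.
  rewrite (chart_local_ring jo jE); exists 1, (al g); split.
  - by exists 1 => //; rewrite rmorph1.
  - by exists g.
  - by move=> [g' Pg' /chart_embed_inj gg]; rewrite gg in Pg'.
  - by rewrite div1r.
move=> _ [Q _ <-] Rg; apply: gU => Qg.
have g0 : al g != 0 by exact: chart_embed_notin Pg.
have : (al @` Q) (al g) by exists g.
rewrite -{1}(nonunits_localizeI (chart_subring jo jE) (chart_prime jo jE Q)).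
rewrite -(chart_local_ring jo jE) => -[[_ /(_ Rg)/eqP]].
by rewrite (negPf g0).
Qed.

(** The hypotheses say E' = E[1/g] without fixing generators of E'. For x in W with 1/g in R_x, the
    ring E' lies between E and R_x, so [localize_intermediate] applies. *)
Lemma model_chart_localize (W : opens X) (E E' : set K) (g : K) :
    is_subring E -> is_subring E' -> model_chart W E -> E g -> g != 0 ->
    E `<=` E' -> E' g^-1 ->
    (forall R, is_subring R -> E `<=` R -> R g^-1 -> E' `<=` R) ->
  model_chart (opensI W (Opens (local_ring_open g^-1))) E'.
Proof.
move=> sE sE' [Wpt Wpr Wb] Eg g0 EE' E'g E'min; split; last first.
- move=> U x [Wx _] Ux; have [z zx zU] := Wb U x Wx Ux.
  by exists z => // y [Wy _]; exact: zU.
- move=> Q pQ; have pP := prime_restrict sE EE' pQ.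
  have [x Wx Rx] := Wpr _ pP.
  have Qg : ~ Q g.
    case: pQ => -[_ _ _ QM] Q1 _ Qg; apply: Q1.
    by rewrite -(mulVf g0); exact: QM.
  have Rg : localize E (Q `&` E) g^-1.
    exists 1, g; split=> //; [by case: sE|by case|by rewrite div1r].
  exists x; first by split=> //=; rewrite Rx.
  rewrite Rx; apply/esym/localize_intermediate => //.
  by apply: E'min => //; [exact: localize_subring|exact: sub_localize].
move=> x [Wx /= Rg]; have [P pP Rx] := Wpt x Wx.
have sR := local_ring_subring x.
have ER : E `<=` local_ring x by rewrite Rx; exact: sub_localize.
have E'R : E' `<=` local_ring x by exact: E'min.
have pN := nonunits_prime sR (local_ring_nonunits x).
pose Q := nonunits (local_ring x) `&` E'.
have pQ : is_prime E' Q by exact: (prime_restrict sE' E'R pN).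
exists Q => //.
have QE : Q `&` E = P.
  rewrite /Q -setIA (setIidr EE') Rx; exact: nonunits_localizeI.
by rewrite (localize_intermediate sE sE' EE' pQ) QE // -Rx.
Qed.

(** The morphism f is dominant: a nonzero g in D is invertible in K because [iota] is injective, so
    g is outside f eta. *)
Lemma structure_generic (V : opens (Spec D)) (P : Spec D) : V P -> V (f eta).
Proof.
move=> VP; have [g Pg gV] := basic_open_base VP; apply: gV => /=.
apply/structure_map_unit; have g0 := injective_neq0 iota_inj Pg.
have [h Kh hK] := phi_bij; exists (h (iota g)^-1); apply: phi_inj.
by rewrite rmorphM phi_structure hK rmorph1 mulfV.
Qed.

(** The ideal J of denominators in D of the value contains, for each P in D(g), an element outside
    P, so [radical_ideal] puts a power of g in J. *)
Lemma ev_structure_denom (V : opens (Spec D)) (s : sect V)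
    (VE : opens_preim (@mcont _ _ f) V eta) (g : D) : basic_open g `<=` V ->
  exists (d : D) (n : nat),
    @ev (opens_preim (@mcont _ _ f) V) VE (pull f V s) * iota g ^+ n = iota d.
Proof.
move=> gV; set z := ev _ _.
pose J := [set d : D | exists d', z * iota d = iota d'].
suff [n [d e]] : exists n, J (g ^+ n) by exists d, n; rewrite -rmorphXn.
apply: radical_ideal.
  split=> //.
  - by exists 0; rewrite !rmorph0 mulr0.
  - by move=> x y [x' ex] [y' ey]; exists (x' + y');
    rewrite !rmorphD mulrDr ex ey.
  - by move=> r x _ [x' ex]; exists (r * x'); rewrite !rmorphM -ex; ring.
move=> P Pg; have VP : V P by exact: gV.
have [Z [ZV [a [b [ZP Pb e]]]]] := sect_local_frac s VP.
exists b => //; exists a.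
have ZE : opens_preim (@mcont _ _ f) Z eta by exact: structure_generic ZP.
have k : opens_preim (@mcont _ _ f) Z `<=` opens_preim (@mcont _ _ f) V.
  by move=> y; exact: ZV.
rewrite -!(ev_structure ZE) /z -(ev_res k ZE VE) -(pull_res ZV k) -rmorphM.
by rewrite -rmorphM e.
Qed.

Definition affine_model_chart (W : opens X) (E : set K) :=
  is_affine_ring iota E /\ model_chart W E.

(* The sections over V need not visibly be finitely generated over D, but once g
   is inverted their images in K lie in D[1/g]. *)
Lemma finite_type_chart (V : opens (Spec D)) (U : opens X) (g : D)
    (h : U `<=` opens_preim (@mcont _ _ f) V) (x0 : X) :
    affine_open U -> finite_type_hom (fun s : sect V => res h (pull f V s)) ->
    basic_open g `<=` V -> U x0 -> ~ spec_ideal (f x0) g ->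
  exists (W : opens X) (E : set K), affine_model_chart W E /\
    forall x, U x -> ~ spec_ideal (f x) g -> W x.
Proof.
move=> [A [j [jo jU]]] [s sT] gV Ux0 gx0.
have UE := generic_mem Ux0.
have jE : range j eta by rewrite jU.
have UjE : range (ev UE) = range (chart_embed jo jE) by exact: chart_range_ev.
pose E := smallest (@is_subring K)
  (range iota `|` [set` (iota g)^-1 :: map (ev UE) s]).
have sE : is_subring E by exact: smallest_subring.
have g0 : iota g != 0 := injective_neq0 iota_inj gx0.
have Eiota d : E (iota d) by move=> R [_ RG]; apply: RG; left; exists d.
have Eg : E (iota g)^-1.
  by move=> R [_ RG]; apply: RG; right; rewrite /= mem_head.
have VE : opens_preim (@mcont _ _ f) V eta by exact: (h _ UE).
have psiE t : ev UE (res h (pull f V t)) =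
    @ev (opens_preim (@mcont _ _ f) V) VE (pull f V t) by rewrite (ev_res h UE
      VE).
(* Finite generation acts as an induction: the sections with value in E form a subring that contains
   the generators s and, by [ev_structure_denom], the image of the sections over V. *)
have evE t : E (ev UE t).
  have tT : [set: sect U] t by [].
  rewrite -sT in tT; apply: (tT (ev UE @^-1` E)); split.
    split.
    - by rewrite /preimage /mkset rmorph1; case: sE.
    - by move=> x y Ex Ey; rewrite /preimage /mkset rmorphB;
      case: sE => _ EB _; exact: EB.
    - by move=> x y Ex Ey; rewrite /preimage /mkset rmorphM;
      exact: (subringM sE Ex Ey).
  move=> r' [[r _ <-]|rs].
    rewrite /preimage /mkset psiE.
    have [d [n e]] := ev_structure_denom r VE gV.
    have -> : @ev (opens_preim (@mcont _ _ f) V) VE (pull f V r) =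
        iota d * (iota g)^-1 ^+ n.
      by rewrite -e exprVn mulfK // expf_neq0.
    by apply: (subringM sE) => //; exact: (subringX _ sE).
  move=> R [_ RG]; apply: RG; right.
  change (ev UE r' \in (iota g)^-1 :: map (ev UE) s).
  by rewrite inE map_f ?orbT.
exists (opensI (chart_open jo) (Opens (local_ring_open (iota g)^-1))), E.
split; last first.
  move=> x Ux gx; split; last exact: local_ring_iotaV.
  by have : range j x by rewrite jU.
split; first by exists ((iota g)^-1 :: map (ev UE) s).
apply: model_chart_localize (model_chart_affine jo jE) _ g0 _ Eg _ => //.
- exact: chart_subring.
- rewrite -UjE; exists (res h (pull f V (const_sect V g))) => //.
  by rewrite psiE ev_structure.
- by rewrite -UjE => _ [t _ <-].
move=> R sR ER Rg; apply: smallest_sub => //; rewrite -UjE in ER.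
move=> z [[d _ <-]|].
  apply: ER; exists (res h (pull f V (const_sect V d))) => //.
  by rewrite psiE ev_structure.
by rewrite /mkset inE => /orP[/eqP-> //|/mapP[t _ ->]]; apply: ER; exists t.
Qed.

Lemma finite_model_charts : exists (J : finType) (W : J -> opens X)
    (E : J -> set K), (forall e, affine_model_chart (W e) (E e)) /\
  forall x, exists e, W e x.
Proof.
have [I [V [VT Vaff]]] := f_finite_type.
have [|L LG LP] := @spec_quasi_compact D
    [set g | exists i, basic_open g `<=` V i].
  move=> P; have [i _ VP] : (\bigcup_i V i) (P : Spec D) by rewrite VT.
  by have [g Pg gV] := basic_open_base VP; exists g => //; exists i.
have hi (l : 'I_(size L)) : exists i, basic_open L`_l `<=` V i.
  by apply: LG; exact: mem_nth.
pose i l := sval (cid (hi l)).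
have iV (l : 'I_(size L)) : basic_open L`_l `<=` V (i l) by exact: (svalP (cid
  (hi l))).
have hn (l : 'I_(size L)) := (Vaff (i l)).2.
have cover x : exists l : 'I_(size L), ~ spec_ideal (f x) L`_l.
  have [g gL gx] := LP (f x);
    have gs : (index g L < size L)%N by rewrite index_mem.
  by exists (Ordinal gs); rewrite /= nth_index.
pose n l := sval (cid (hn l)).
pose U l : 'I_(n l) -> opens X := sval (cid (svalP (cid (hn l)))).
have UP (l : 'I_(size L)) : f @^-1` V (i l) = \bigcup_k U l k /\
    forall k, affine_open (U l k) /\
    exists h : U l k `<=` opens_preim (@mcont _ _ f) (V (i l)),
    finite_type_hom (fun s : sect (V (i l)) => res h (pull f (V (i l)) s)).
  exact: (svalP (cid (svalP (cid (hn l))))).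
(* A chart is indexed by one of the finitely many g and one of the affine opens that cover the
   preimage of the chosen V i containing D(g). *)
pose J : finType := {l : 'I_(size L) & 'I_(n l)}.
pose B (e : J) : set X :=
  [set x | U (tag e) (tagged e) x /\ ~ spec_ideal (f x) L`_(tag e)].
have Bcover x : exists e, B e x.
  have [l gl] := cover x; have /iV Vx : basic_open L`_l (f x) by [].
  have [/seteqP[/(_ x Vx)[k _ Ux] _] _] := UP l.
  by exists (Tagged (fun l => 'I_(n l)) k).
have chart (e : J) x0 : B e x0 -> exists WE : opens X * set K,
    affine_model_chart WE.1 WE.2 /\ B e `<=` WE.1.
  move=> [Ux0 gx0]; have [_ /(_ (tagged e))[Uaff [h hft]]] := UP (tag e).
  have [W [E [WE UW]]] := finite_type_chart Uaff hft (@iV (tag e)) Ux0 gx0.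
  by exists (W, E); split=> // x [Ux gx]; exact: UW.
have chartT (e : J) : exists WE : opens X * set K,
    affine_model_chart WE.1 WE.2 /\ B e `<=` WE.1.
  have [[x0 Be]|Be] := pselect (exists x, B e x); first exact: chart Be.
  (* An empty piece has no point to start from; it gets the chart of a piece containing eta as a
     default. *)
  have [e0 Be0] := Bcover eta; have [WE [WEc _]] := chart _ _ Be0.
  by exists WE; split=> // x Bx; case: Be; exists x.
pose c e := sval (cid (chartT e)).
have cP e : affine_model_chart (c e).1 (c e).2 /\ B e `<=` (c e).1.
  exact: (svalP (cid (chartT e))).
exists J, (fun e => (c e).1), (fun e => (c e).2); split=> [e|x].
  by have [] := cP e.
by have [e /(cP e).2] := Bcover x; exists e.
Qed.

(** * The model and the isomorphism *)

Lemma local_rings_model : is_model iota (range local_ring).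
Proof.
have [J [W [E [WE cov]]]] := finite_model_charts; split.
- split; first by exists (local_ring eta), eta.
  move=> _ [x _ <-]; split; [|by move=> _ [d _ <-]; exact: iota_local_ring|].
    exact: (nonunits_local (local_ring_subring x) (local_ring_nonunits x)).
  exact: local_ring_frac.
- move=> _ _ V [x _ <-] [y _ <-] vV [xV [MV [Mx [hV hx ex]]]].
  move=> [yV [MV' [My [hV' hy ey]]]].
  have [sV _] := vV; have iV := valuation_nonunits vV.
  move: hV hV' => /(nonunits_max _ sV iV) hV /(nonunits_max _ sV iV) hV'.
  move: hx => /(nonunits_max _ (local_ring_subring x) (local_ring_nonunits x))
    hx.
  move: hy => /(nonunits_max _ (local_ring_subring y) (local_ring_nonunits y))
    hy.
  subst; congr local_ring.
  exact: (dominated_point_eq sV (nonunits_prime sV iV)).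
exists #|J|, (E \o enum_val); split=> [e|]; first by have [] := WE (enum_val e).
apply/seteqP; split=> [_ [x _ <-]|_ [e _ [P pP ->]]].
  have [e Wx] := cov x; exists (enum_rank e) => //=; rewrite enum_rankK.
  by have [_ [/(_ x Wx)[P pP ->] _ _]] := WE e; exists P.
by have [_ [_ /(_ P pP)[x Wx <-] _]] := WE (enum_val e); exists x.
Qed.

Definition local_rings : model iota := Model local_rings_model.

Local Notation Y := (model_space local_rings).

Lemma local_ring_inj : injective local_ring.
Proof.
move=> x y xy; have sx := local_ring_subring x.
have Nx := local_ring_nonunits x.
have NI : nonunits (local_ring x) = nonunits (local_ring x) `&` local_ring x.
  by apply/esym/setIidl => z [].
by apply: (dominated_point_eq sx (nonunits_prime sx Nx)); rewrite -?xy.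
Qed.

Definition to_model (x : X) : Y := @ModelPt D K iota local_rings (local_ring x)
  (ex_intro2 _ _ x I erefl).

Definition of_model (R : Y) : X := s2val (cid2 (pt_in R)).

Lemma of_modelE (R : Y) : local_ring (of_model R) = pt_ring R.
Proof. exact: (s2valP' (cid2 (pt_in R))). Qed.

Lemma to_modelK : cancel to_model of_model.
Proof. by move=> x; apply: local_ring_inj; rewrite of_modelE. Qed.

Lemma of_modelK : cancel of_model to_model.
Proof.
move=> R; have := of_modelE R; rewrite /to_model.
case: R => R RY; set x := of_model _; move: x => x /= xR; subst R.
by congr ModelPt; exact: Prop_irrelevance.
Qed.

Lemma to_model_continuous : continuous to_model.
Proof.
apply/continuousP => V oV; rewrite openE => x Vx.
have [H HR HV] := oV _ Vx; rewrite /interior.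
have HU : nbhs x [set y | [set` H] `<=` local_ring y].
  elim: H HR {HV} => [|z H IH] HR.
    by apply: filterS filterT => y _ t.
  have zx : nbhs x [set y | local_ring y z].
    by apply: (open_nbhs_nbhs (conj (local_ring_open z) _)); apply: HR;
      exact: mem_head.
  have Hx : nbhs x [set y | [set` H] `<=` local_ring y].
    by apply: IH => t tH; apply: HR; rewrite /= inE tH orbT.
  apply: filterS (filterI zx Hx) => y [zy Hy] t /=.
  by rewrite inE => /orP[/eqP->|/Hy].
by apply: filterS HU => y Hy; exact: HV.
Qed.

(** The neighbourhood consists of the rings that contain the generators s of E and the element z.
    The generators force E into R_y, hence y into the chart, and there z forces y into U. *)
Lemma of_model_continuous : continuous of_model.
Proof.
apply/continuousP => U oU.
change (@model_open D K iota local_rings (of_model @^-1` U)) => R UR.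
set x := of_model R.
have [J [W [E [WE cov]]]] := finite_model_charts.
have [e Wx] := cov x; have [[s Es] [Wpt Wpr Wb]] := WE e.
have [z zx zU] := Wb (Opens oU) x Wx UR.
have sE : is_subring (E e) by rewrite Es; exact: smallest_subring.
exists (z :: s).
  rewrite -of_modelE -/x => t /=; rewrite inE => /orP[/eqP-> //|ts].
  have [P pP ->] := Wpt x Wx; apply: sub_localize => //.
  by rewrite Es; apply: sub_gen_smallest; right.
move=> S HS; rewrite /preimage /mkset; set y := of_model S.
have yS : local_ring y = pt_ring S := of_modelE S.
have sy := local_ring_subring y; have Ny := local_ring_nonunits y.
have Ey : E e `<=` local_ring y.
  rewrite Es; apply: smallest_sub => // t [[d _ <-]|ts].
    exact: iota_local_ring.
  by rewrite yS; apply: HS; rewrite /= inE ts orbT.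
have pQ := prime_restrict sE Ey (nonunits_prime sy Ny).
have [w Ww Rw] := Wpr _ pQ.
(* R_y dominates the localization of E at its centre; this localization is the local ring of a point
   w of the chart. *)
have [wy Nw] := localize_dominated sy Ny sE Ey; rewrite -Rw in wy Nw.
suff wyE : w = y.
  by apply: zU; rewrite -wyE // wyE yS; apply: HS; rewrite /= mem_head.
apply: (dominated_point_eq sy (nonunits_prime sy Ny)) => //.
by apply/esym/setIidl => t [].
Qed.

Lemma model_sect_eq (V : opens Y) (s t : @sect Y V) :
  (forall R : Y, V R -> sect_val s = sect_val t) -> s = t.
Proof.
move=> e; apply: model_sect_inj.
have [V0|/eqP/set0P[R VR]] := pselect (oset V = set0); last exact: (e R VR).
by have [/(_ V0)-> _] := sect_valP s; have [/(_ V0)-> _] := sect_valP t.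
Qed.

Lemma sect_val_res (U V : opens Y) (h : V `<=` U) (s : @sect Y U) (R : Y) :
  V R -> sect_val (@res Y U V h s : model_sect V) = sect_val s.
Proof. by move=> VR /=; case: asboolP => // V0; move: VR; rewrite V0. Qed.

Lemma sect_val1 (V : opens Y) (R : Y) :
  V R -> sect_val (1 : @sect Y V) = 1.
Proof. by move=> VR /=; case: asboolP => // V0; move: VR; rewrite V0. Qed.

Lemma sect_valM (V : opens Y) (s t : @sect Y V) :
  sect_val (s * t : @sect Y V) = sect_val s * sect_val t.
Proof. by []. Qed.

Lemma sect_valB (V : opens Y) (s t : @sect Y V) :
  sect_val (s - t : @sect Y V) = sect_val s - sect_val t.
Proof. by []. Qed.

Lemma to_model_pull_ex (V : opens Y) (t : @sect Y V) :
  exists s : sect (opens_preim to_model_continuous V),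
    forall UE : opens_preim to_model_continuous V eta, ev UE s = sect_val t.
Proof. by apply: sect_glue => x Vx; have [_ tV] := sect_valP t;
  exact: (tV (to_model x) Vx). Qed.

Definition to_model_pull (V : opens Y) (t : @sect Y V) :
  sect (opens_preim to_model_continuous V) := sval (cid (to_model_pull_ex t)).

Lemma to_model_pullE (V : opens Y) (t : @sect Y V)
    (UE : opens_preim to_model_continuous V eta) :
  ev UE (to_model_pull t) = sect_val t.
Proof. exact: (svalP (cid (to_model_pull_ex t))). Qed.

Fact to_model_pull_zmod V : zmod_morphism (@to_model_pull V).
Proof.
by move=> s t; apply: sect_uniq => UE; rewrite rmorphB !to_model_pullE.
Qed.

Fact to_model_pull_monoid V : monoid_morphism (@to_model_pull V).
Proof.
split=> [|s t]; apply: sect_uniq => UE; rewrite ?rmorphM !to_model_pullE //.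
by rewrite rmorph1 (sect_val1 (UE : V (to_model eta))).
Qed.

HB.instance Definition _ V :=
  GRing.isZmodMorphism.Build _ _ (@to_model_pull V) (@to_model_pull_zmod V).
HB.instance Definition _ V :=
  GRing.isMonoidMorphism.Build _ _ (@to_model_pull V) (@to_model_pull_monoid V).

Fact to_model_pull_res (U V : opens Y) (h : V `<=` U)
  (k : opens_preim to_model_continuous V `<=` opens_preim to_model_continuous U)
  (t : @sect Y U) : to_model_pull (res h t) = res k (to_model_pull t).
Proof.
apply: sect_uniq => VE; rewrite (ev_res k VE (k _ VE)) !to_model_pullE.
exact: sect_val_res (VE : V (to_model eta)).
Qed.

Lemma model_ring_open (z : K) : open [set R : Y | pt_ring R z].
Proof.
change (@model_open D K iota local_rings [set R : Y | pt_ring R z]) => R Rz.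
exists [:: z] => [t|S HS]; first by rewrite /= inE => /eqP->.
by apply: HS; exact: mem_head.
Qed.

Fact to_model_pull_local (x : X) (V : opens Y) (Vx : V (to_model x))
    (t : @sect Y V) :
  is_unit (@germ X x (opens_preim to_model_continuous V) Vx (to_model_pull t))
    ->
  is_unit (germ Vx t).
Proof.
have UE := @generic_mem (opens_preim to_model_continuous V) x Vx.
move=> /(germ_unit_ev UE); rewrite to_model_pullE => -[t0 tx].
(* The inverse lies in R_x but perhaps not in every ring of V, so V is shrunk to the open set of
   rings that contain it. *)
pose W := opensI V (Opens (@model_ring_open (sect_val t)^-1)).
have WV : W `<=` V by exact: opensIl.
have tW : @model_ring D K iota local_rings W (sect_val t)^-1.
  split=> [W0|R [_ Rt]//].
  by have : W (to_model x) by []; rewrite W0.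
apply/germ_unitP; exists W, WV, (ModelSect tW); split=> //.
apply: model_sect_eq => R WR.
by rewrite sect_valM (sect_val_res _ _ WR) (sect_val1 WR) /= mulfV.
Qed.

Definition to_model_morphism : morphism X Y :=
  @Morphism X Y to_model to_model_continuous
    (fun V => (@to_model_pull V : {rmorphism @sect Y V -> sect _}))
    to_model_pull_res to_model_pull_local.

(* U eta only fails for the empty U. *)
Definition generic_val (U : opens X) (s : sect U) : K :=
  if pselect (U eta) is left UE then ev UE s else 0.

Lemma generic_valE (U : opens X) (UE : U eta) (s : sect U) :
  generic_val s = ev UE s.
Proof.
rewrite /generic_val; case: pselect => // UE'.
by rewrite (Prop_irrelevance UE' UE).
Qed.

Lemma of_model_generic (U : opens X) (R : Y) :
  opens_preim of_model_continuous U R -> U eta.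
Proof. exact: generic_mem. Qed.

Fact of_model_pullP (U : opens X) (s : sect U) :
  @model_ring D K iota local_rings (opens_preim of_model_continuous U)
    (generic_val s).
Proof.
(* If the preimage of U is empty then eta is not in U; the default 0 of [generic_val] is then the
   only section allowed. *)
split=> [U0|R UR].
  rewrite /generic_val; case: pselect => // UE; exfalso.
  have : opens_preim of_model_continuous U (to_model eta).
    by rewrite /= /preimage /mkset to_modelK.
  by rewrite U0.
rewrite (generic_valE (of_model_generic UR)) -of_modelE.
exact: local_ring_ev.
Qed.

Definition of_model_pull (U : opens X) (s : sect U) :
  @sect Y (opens_preim of_model_continuous U) := ModelSect (of_model_pullP s).

Lemma of_model_pullE (U : opens X) (UE : U eta) (s : sect U) :
  sect_val (of_model_pull s) = ev UE s.
Proof. exact: generic_valE. Qed.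

Fact of_model_pull_zmod U : zmod_morphism (@of_model_pull U).
Proof.
move=> s t; apply: model_sect_eq => R /of_model_generic UE.
by rewrite sect_valB !(of_model_pullE UE) rmorphB.
Qed.

Fact of_model_pull_monoid U : monoid_morphism (@of_model_pull U).
Proof.
split=> [|s t]; apply: model_sect_eq => R UR; have UE := of_model_generic UR.
  by rewrite (of_model_pullE UE) (sect_val1 UR) rmorph1.
by rewrite sect_valM !(of_model_pullE UE) rmorphM.
Qed.

HB.instance Definition _ U :=
  GRing.isZmodMorphism.Build _ _ (@of_model_pull U) (@of_model_pull_zmod U).
HB.instance Definition _ U :=
  GRing.isMonoidMorphism.Build _ _ (@of_model_pull U) (@of_model_pull_monoid U).

Fact of_model_pull_res (U V : opens X) (h : V `<=` U)
  (k : opens_preim of_model_continuous V `<=` opens_preim of_model_continuous U)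
  (s : sect U) : of_model_pull (res h s) = @res Y _ _ k (of_model_pull s).
Proof.
apply: model_sect_eq => R VR; have VE := of_model_generic VR.
by rewrite (sect_val_res _ _ VR) (of_model_pullE VE) (of_model_pullE (h _ VE))
  (ev_res h VE (h _ VE)).
Qed.

Fact of_model_pull_local (R : Y) (U : opens X) (UR : U (of_model R))
    (s : sect U) :
  is_unit (@germ Y R (opens_preim of_model_continuous U) UR (of_model_pull s))
    ->
  is_unit (germ UR s).
Proof.
have UE := generic_mem UR.
move=> /germ_unitP[W [h [t [WR /(congr1 (@sect_val _ _ _ _ _))]]]].
rewrite sect_valM (sect_val_res _ _ WR) (sect_val1 WR) (of_model_pullE UE) => e.
apply/(germ_unit_ev UE).
have s0 : ev UE s != 0.
  by apply/eqP => s0; move/eqP: e; rewrite s0 mul0r eq_sym oner_eq0.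
split=> //; have -> : (ev UE s)^-1 = sect_val t.
  by apply: (mulfI s0); rewrite e mulfV.
by rewrite of_modelE; have [_ tW] := sect_valP t; exact: (tW R WR).
Qed.

Definition of_model_morphism : morphism Y X :=
  @Morphism Y X of_model of_model_continuous
    (fun U => (@of_model_pull U : {rmorphism sect U -> @sect Y _}))
    of_model_pull_res of_model_pull_local.

(** Both pullbacks preserve values in K, and on both spaces values determine sections, so the
    composites are identities. *)
Lemma local_rings_isomorphic : isomorphic Y X.
Proof.
exists of_model_morphism, to_model_morphism; split; split.
- exact: of_modelK.
- move=> V W h k s; apply: model_sect_eq => R WR.
  rewrite (sect_val_res h _ WR) (sect_val_res k _ WR) pull_comp pull_id.
  rewrite (sect_val_res _ _ (h R WR)) (sect_val_res _ _ (k R WR)).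
  have UE := @of_model_generic (opens_preim to_model_continuous V) R (h R WR).
  exact: etrans (of_model_pullE UE _) (to_model_pullE s UE).
- exact: to_modelK.
move=> V W h k s; apply: sect_uniq => WE; rewrite pull_comp pull_id.
rewrite (ev_res h WE (h _ WE)) (ev_res k WE (k _ WE)).
rewrite (ev_res (@id_sub _ V) (k _ WE) (k _ WE)).
rewrite (ev_res (@comp_sub _ _ _ of_model_morphism to_model_morphism V)
  (h _ WE) (h _ WE)).
apply: etrans (to_model_pullE _ _) _; exact: of_model_pullE.
Qed.

End Structure.

End FunctionField.

Theorem proposition2p6 (D : idomainType) (K : fieldType)
    (iota : {rmorphism D -> K}) (iota_inj : injective iota)
    (X : ringedSpace) (f : morphism X (Spec D))
    (X_scheme : is_scheme X) (X_integral : is_integral X)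
    (f_separated : separated f) (f_finite_type : finite_type f)
    (eta : X) (eta_generic : generic_point eta)
    (phi : {rmorphism stalk eta -> K}) (phi_bij : bijective phi)
    (phi_structure : forall d : D, phi (structure_map f eta d) = iota d) :
  exists Y : model iota, isomorphic (model_space Y) X.
Proof.
exists (local_rings X_scheme X_integral eta_generic phi_bij f_separated
  f_finite_type iota_inj phi_structure).
exact: local_rings_isomorphic.
Qed.
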